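(* Suppose there exists an algorithm $A$ which, for any unweighted $n$-vertex graph, finds a $3$-separated weak-diameter clustering with weak-diameter $D(n)$ and average overlap at most $\xi_{\mathrm{AVG}}(n)$. Then there is an algorithm $A'$ that, given an unweighted $n$-vertex graph, builds a $\beta$-spanner $H$ with (1) $|E(H)|=O(\xi_{\mathrm{AVG}}(n)\,n)$ and (2) $\beta=O(D(n))$. Furthermore, if $A$ is deterministic then so is $A'$, and: (i) if $A$ requires at most $T(n)$ $\mathsf{CONGEST}$ rounds, then $A'$ requires $O(\log(n)\,T(n))$ $\mathsf{CONGEST}$ rounds; (ii) if $A$ requires at most $T(n,r)$ $\mathsf{CONGEST}$ rounds on an $r$-cluster-graph, then $A'$ requires $O(\log(n)(T(n,r)+r))$ $\mathsf{CONGEST}$ rounds on an $r$-cluster-graph; (iii) if $A$ is a $\mathsf{PRAM}$ algorithm with depth $T(n)$ and work $W(m,n)$, then $A'$ is a $\mathsf{PRAM}$ algorithm with depth $O(\log(n)\,T(n))$ and work $O(\mathrm{poly}(\log n)(W(m,n)+m+n\,\xi_{\mathrm{AVG}}(n)))$, where $m$ is the number of edges.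
   Context: For an unweighted graph $G$ with $n$ vertices, a $t$-separated weak-diameter clustering with weak-diameter $D$ and average overlap $\xi_{\mathrm{AVG}}$ is a set $\mathcal{C}$ of pairwise disjoint vertex sets (clusters), each cluster $C$ coming with a tree $T_C$ in $G$ with $V(T_C)\supseteq C$, such that: $\mathrm{diam}(T_C)\le D$ for each $C$; $d_G(C_1,C_2)\ge t$ for distinct clusters (where $d(A,B)=\min_{a\in A,b\in B}d(a,b)$); $|\bigcup_{C\in\mathcal{C}}C|\ge n/2$; and $\sum_{v\in V(G)}\xi(v)\le n\,\xi_{\mathrm{AVG}}$ where $\xi(v)$ is the number of trees $T_C$ containing $v$. A subgraph $H$ of $G$ is a $\beta$-spanner if $d_H(u,v)\le\beta\, d_G(u,v)$ for all vertices $u,v$. $\mathsf{CONGEST}$ model: the network is $G$; each node has a unique $O(\log n)$-bit identifier, initially knows only its incident edges, and per synchronous round sends one $O(\log n)$-bit message to each neighbor. An $r$-clustering is a set of disjoint clusters each of whose induced subgraphs contains a rooted spanning tree of hop-radius at most $r$; an $r$-cluster-graph of $G$ is obtained by contracting each cluster of an $r$-clustering to a single node; running on an $r$-cluster-graph means the communication network is $G$ while the input/output concern the cluster-graph. *)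

(* Defs.v *)
From mathcomp Require Import all_boot all_order all_algebra.
From mathcomp Require Import boolp reals.

Set Implicit Arguments.
Unset Strict Implicit.
Unset Printing Implicit Defensive.

Import Order.TTheory GRing.Theory Num.Theory.

(* Throughout, the size parameter [n] of an algorithm is an upper bound on the
   number of vertices of its input: D(n), xi(n), T(n), ... are worst cases over
   all graphs with at most [n] vertices. *)

Record sgraph := SGraph {
  vert :> finType;
  adj : rel vert;
  adj_sym : symmetric adj;
  adj_irr : irreflexive adj }.

Definition edges (G : sgraph) : {set {set G}} :=
  [set [set p.1; p.2] | p : G * G & adj p.1 p.2].

Definition erel (V : finType) (F : {set {set V}}) : rel V :=
  fun u v => [set u; v] \in F.

(* d(u,v) <= k; never holds when u and v are disconnected. *)
Definition dist_le (V : finType) (e : rel V) (u v : V) (k : nat) : Prop :=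
  exists p : seq V, [/\ path e u p, last u p = v & size p <= k].

Definition dist_ge (V : finType) (e : rel V) (u v : V) (t : nat) : Prop :=
  forall k, dist_le e u v k -> t <= k.

Definition is_tree (G : sgraph) (U : {set G}) (F : {set {set G}}) : Prop :=
  [/\ F \subset edges G,
      {in F, forall f : {set G}, f \subset U},
      U != set0,
      {in U &, forall u v, connect (erel F) u v}
    & forall p : seq G, ucycle (erel F) p -> size p <= 2].

(* [tverts C] and [tedges C] are the vertex and edge sets of T_C; they are
   meaningless when C is not a cluster. *)
Record clustering (G : sgraph) := Clustering {
  clusters : {set {set G}};
  tverts : {set G} -> {set G};
  tedges : {set G} -> {set {set G}} }.

Definition overlap (G : sgraph) (X : clustering G) (v : G) : nat :=
  #|[set C in clusters X | v \in tverts X C]|.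

Definition weak_diam_clustering (R : realType) (G : sgraph) (t D : nat) (xi : R)
    (X : clustering G) : Prop :=
  [/\ trivIset (clusters X),
      {in clusters X, forall C : {set _},
         [/\ is_tree (tverts X C) (tedges X C),
             C \subset tverts X C
           & {in tverts X C &, forall u v, dist_le (erel (tedges X C)) u v D}]},
      {in clusters X &, forall C1 C2 : {set G}, C1 != C2 ->
         {in C1 & C2, forall a b, dist_ge (@adj G) a b t}},
      #|G| <= 2 * #|cover (clusters X)|
    & ((\sum_(v : G) overlap X v)%N%:R <= #|G|%:R * xi)%R].

Definition is_spanner (G : sgraph) (beta : nat) (H : {set {set G}}) : Prop :=
  H \subset edges G /\
  forall (u v : G) k,
    dist_le (@adj G) u v k -> dist_le (erel H) u v (beta * k).

Inductive rnd (A : Type) : Type :=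
| Ret of A
| Coin of (bool -> rnd A).

Fixpoint bind (A B : Type) (x : rnd A) (f : A -> rnd B) : rnd B :=
  match x with
  | Ret a => f a
  | Coin k => Coin (fun b => bind (k b) f)
  end.

Fixpoint pr (R : realType) (A : Type) (x : rnd A) (P : A -> Prop) : R :=
  match x with
  | Ret a => (`[< P a >] : nat)%:R
  | Coin k => ((pr R (k true) P + pr R (k false) P) / 2)%R
  end.

Definition coinless (A : Type) (x : rnd A) : Prop := exists a, x = Ret a.

(* In a round a node makes a (possibly randomized) local computation, sends
   one bit string to each neighbour (named by its identifier), and updates its
   state with the strings received. *)
Record protocol (In Out : Type) := Protocol {
  state : Type;
  init : In -> state;
  compute : state -> rnd state;
  send : state -> nat -> bitseq;
  recv : state -> (nat -> bitseq) -> state;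
  output : state -> Out }.

Definition congest_det (In Out : Type) (P : protocol In Out) : Prop :=
  forall s : state P, coinless (compute s).

Definition bandwidth (In Out : Type) (P : protocol In Out) (k : nat) : Prop :=
  forall (s : state P) (u : nat), size (send s u) <= k.

Definition valid_ids (G : sgraph) (n c : nat) (id : G -> nat) : Prop :=
  injective id /\ forall v, id v < n ^ c.

Section Execution.
Context (In Out : Type) (P : protocol In Out) (G : sgraph) (id : G -> nat).

Definition upd (st : G -> state P) (v : G) (s : state P) : G -> state P :=
  fun w => if w == v then s else st w.

Definition compute_all : (G -> state P) -> rnd (G -> state P) :=
  foldr (fun v k st => bind (compute (st v)) (fun s => k (upd st v s)))
        (@Ret _) (enum G).

Definition inbox (st : G -> state P) (v : G) : nat -> bitseq := fun k =>
  if [pick u | adj v u && (id u == k)] is Some u then send (st u) (id v)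
  else [::].

Definition round (st : G -> state P) : rnd (G -> state P) :=
  bind (compute_all st)
    (fun st' => Ret (fun v => recv (st' v) (inbox st' v))).

Fixpoint rounds (t : nat) (st : G -> state P) : rnd (G -> state P) :=
  if t is t'.+1 then bind (round st) (rounds t') else Ret st.

Definition congest_output (inp : G -> In) (t : nat) : rnd (G -> Out) :=
  bind (rounds t (fun v => init P (inp v)))
    (fun st => Ret (fun v => output (st v))).

End Execution.

Definition nbr_ids (G : sgraph) (id : G -> nat) (v : G) : seq nat :=
  sort leq [seq id u | u <- enum (adj v)].

(* Own identifier, identifiers of the neighbours. *)
Definition input : Type := (nat * seq nat)%type.
Definition node_input (G : sgraph) (id : G -> nat) (v : G) : input :=
  (id v, nbr_ids id v).

(* An r-cluster-graph of G.  The fibres of [cg_proj] are the clusters, vertices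
   outside the r-clustering being their own (singleton) fibre, which is what
   contraction makes of them.  The rooted spanning tree of a cluster is given by
   parent pointers leading to [cg_center]; at a root the parent is irrelevant. *)
Record cluster_graph (r : nat) (G : sgraph) := ClusterGraph {
  cg :> sgraph;
  cg_proj : G -> cg;
  cg_center : cg -> G;
  cg_parent : G -> G;
  cg_adj : forall x y : cg,
    adj x y = (x != y) &&
      [exists u, exists v, [&& adj u v, cg_proj u == x & cg_proj v == y]];
  cg_centerK : cancel cg_center cg_proj;
  cg_parentP : forall v, v != cg_center (cg_proj v) ->
    adj v (cg_parent v) /\ cg_proj (cg_parent v) = cg_proj v;
  cg_radius : forall v, exists2 k, k <= r &
    iter k cg_parent v = cg_center (cg_proj v) }.

(* In addition: identifiers of the centre of one's cluster and of one's parent. *)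
Definition cg_input : Type := (input * (nat * nat))%type.
Definition cg_node_input (r : nat) (G : sgraph) (Q : cluster_graph r G)
    (id : G -> nat) (v : G) : cg_input :=
  (node_input id v, (id (cg_center (cg_proj Q v)), id (cg_parent Q v))).

(* Distributed outputs describe objects of a graph Q obtained from the network G
   through [proj : G -> Q] (Q = G and proj = id when there is no contraction).
   A set F of edges of Q is output as a set of marked edges of G, known to both
   endpoints: {x,y} is in F iff some marked edge of G projects onto it. *)
Definition encodes_edges (G Q : sgraph) (id : G -> nat) (proj : G -> Q)
    (marks : G -> seq nat) (F : {set {set Q}}) : Prop :=
  (forall u k, k \in marks u ->
     exists v, [/\ adj u v, id v = k & id u \in marks v]) /\
  (forall x y : Q, [set x; y] \in F <->
     exists u v, [/\ proj u = x, proj v = y & id v \in marks u]).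

(* Each node outputs the label of its cluster, if any, and the tree edges
   incident to it, each tagged with the label of its tree's cluster. *)
Definition cl_out : Type := (option nat * seq (nat * nat))%type.

Definition encodes_clustering (G Q : sgraph) (id : G -> nat) (proj : G -> Q)
    (out : G -> cl_out) (X : clustering Q) : Prop :=
  exists lab : {set Q} -> nat,
  [/\ {in clusters X &, injective lab},
      forall v l, (out v).1 = Some l <->
        exists C, [/\ C \in clusters X, proj v \in C & lab C = l],
      {in clusters X, forall C : {set _},
         encodes_edges id proj
           (fun u => [seq a.2 | a <- (out u).2 & a.1 == lab C]) (tedges X C)}
    & forall v a, a \in (out v).2 ->
        exists2 C, C \in clusters X & lab C = a.1].

Definition congest_clusters (R : realType) (n c T D : nat) (xi delta : R)
    (A : protocol input cl_out) : Prop :=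
  forall (G : sgraph) (id : G -> nat), #|G| <= n -> valid_ids n c id ->
    (1 - delta <= pr R (congest_output A id (node_input id) T)
       (fun out => exists X : clustering G,
          weak_diam_clustering 3 D xi X /\ encodes_clustering id idfun out X))%R.

Definition congest_spans (R : realType) (n c T beta : nat) (sz delta : R)
    (A : protocol input (seq nat)) : Prop :=
  forall (G : sgraph) (id : G -> nat), #|G| <= n -> valid_ids n c id ->
    (1 - delta <= pr R (congest_output A id (node_input id) T)
       (fun out => exists H : {set {set G}},
          [/\ is_spanner beta H, (#|H|%:R <= sz * #|G|%:R)%R
            & encodes_edges id idfun out H]))%R.

Definition cg_congest_clusters (R : realType) (n r c T D : nat) (xi delta : R)
    (A : protocol cg_input cl_out) : Prop :=
  forall (G : sgraph) (Q : cluster_graph r G) (id : G -> nat),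
    #|G| <= n -> valid_ids n c id ->
    (1 - delta <= pr R (congest_output A id (cg_node_input Q id) T)
       (fun out => exists X : clustering Q,
          weak_diam_clustering 3 D xi X /\
          encodes_clustering id (cg_proj Q) out X))%R.

Definition cg_congest_spans (R : realType) (n r c T beta : nat) (sz delta : R)
    (A : protocol cg_input (seq nat)) : Prop :=
  forall (G : sgraph) (Q : cluster_graph r G) (id : G -> nat),
    #|G| <= n -> valid_ids n c id ->
    (1 - delta <= pr R (congest_output A id (cg_node_input Q id) T)
       (fun out => exists H : {set {set Q}},
          [/\ is_spanner beta H, (#|H|%:R <= sz * #|Q|%:R)%R
            & encodes_edges id (cg_proj Q) out H]))%R.

(* A priority CRCW PRAM in work-depth form, with unit-cost addition and
   truncated subtraction.  Shared memory is a family of arrays: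
   [s a i] is cell [i] of array [a]. *)
Definition store := nat -> nat -> nat.

Inductive expr :=
| Const of nat
| Proc
| Read of nat & expr
| Add of expr & expr
| Sub of expr & expr.

Fixpoint eval (s : store) (p : nat) (e : expr) : nat :=
  match e with
  | Const k => k
  | Proc => p
  | Read a i => s a (eval s p i)
  | Add e1 e2 => eval s p e1 + eval s p e2
  | Sub e1 e2 => eval s p e1 - eval s p e2
  end.

(* [Par k g a i x]: simultaneously for all processors p < k such that g(p) <> 0,
   array a at i(p) := x(p); the smallest p wins a write conflict.
   [Flip k a]: array a at p := random bit, for all processors p < k.
   The number of processors and the tests are evaluated by processor 0. *)
Inductive instr :=
| Par of expr & expr & nat & expr & expr
| Flip of expr & nat
| If of expr & seq instr & seq instr
| While of expr & seq instr.

Definition program := seq instr.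

Fixpoint instr_det (c : instr) : bool :=
  match c with
  | Par _ _ _ _ _ => true
  | Flip _ _ => false
  | If _ c1 c2 => all instr_det c1 && all instr_det c2
  | While _ c1 => all instr_det c1
  end.

Definition pram_det (p : program) : bool := all instr_det p.

Definition write_par (s : store) (k : nat) (g : expr) (a : nat) (i x : expr)
    : store := fun b j =>
  if b != a then s b j else
  if [seq p <- iota 0 k | (eval s p g != 0) && (eval s p i == j)] is p :: _
  then eval s p x else s b j.

Fixpoint flips (k : nat) : rnd (seq bool) :=
  if k is k'.+1 then Coin (fun b => bind (flips k') (fun l => Ret (b :: l)))
  else Ret [::].

Definition write_bits (s : store) (a : nat) (l : seq bool) : store := fun b j =>
  if (b == a) && (j < size l) then nat_of_bool (nth false l j) else s b j.

(* Remaining code, memory, work done so far. *)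
Record config := Config { code : program; memory : store; work : nat }.

(* One unit of depth. *)
Definition step (x : config) : rnd config :=
  let: Config p s w := x in
  match p with
  | [::] => Ret x
  | Par k g a i e :: q =>
      let k := eval s 0 k in
      Ret (Config q (write_par s k g a i e) (w + k).+1)
  | Flip k a :: q =>
      let k := eval s 0 k in
      bind (flips k) (fun l => Ret (Config q (write_bits s a l) (w + k).+1))
  | If e c1 c2 :: q =>
      Ret (Config ((if eval s 0 e != 0 then c1 else c2) ++ q) s w.+1)
  | While e c :: q =>
      Ret (Config (if eval s 0 e != 0 then c ++ p else q) s w.+1)
  end.

Fixpoint steps (t : nat) (x : config) : rnd config :=
  if t is t'.+1 then bind (step x) (steps t') else Ret x.

(* Array 0 holds n and m.  Vertices are named by numbers below n; array 1 flags
   the names in use.  Arrays 2 and 3 hold the endpoints of the m edge slots; a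
   slot with an unused endpoint is vacant.  All other memory is arbitrary. *)
Definition slot (G : sgraph) (name : G -> nat) (s : store) (e : nat) (u v : G)
    : Prop := s 2 e = name u /\ s 3 e = name v.

Record pram_input (n m : nat) (G : sgraph) (name : G -> nat) (s : store)
    : Prop := PramInput {
  pin_n : s 0 0 = n;
  pin_m : s 0 1 = m;
  pin_inj : injective name;
  pin_name : forall v, name v < n;
  pin_used : forall i, i < n -> s 1 i != 0 <-> exists v, name v = i;
  pin_ends : forall e, e < m -> s 2 e < n /\ s 3 e < n;
  pin_adj : forall e u v, e < m -> slot name s e u v -> adj u v;
  pin_slot : forall u v, adj u v ->
    exists! e, e < m /\ (slot name s e u v \/ slot name s e v u) }.

(* Array 4 holds at each vertex 0 if it is not clustered, and otherwise 1 plus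
   the label of its cluster.  Array 5 holds the total number K of tree edges,
   and arrays 6 and 7 list these without repetition: cluster label, edge slot.
   [s] is the initial memory, [s'] the final one. *)
Definition pram_encodes_clustering (m : nat) (G : sgraph) (name : G -> nat)
    (s s' : store) (X : clustering G) : Prop :=
  exists lab : {set G} -> nat,
  [/\ {in clusters X &, injective lab},
      forall v l, s' 4 (name v) = l.+1 <->
        exists C, [/\ C \in clusters X, v \in C & lab C = l],
      forall j, j < s' 5 0 -> s' 7 j < m /\
        exists C u v, [/\ C \in clusters X, s' 6 j = lab C,
          slot name s (s' 7 j) u v & [set u; v] \in tedges X C],
      forall i j, i < s' 5 0 -> j < s' 5 0 ->
        s' 6 i = s' 6 j -> s' 7 i = s' 7 j -> i = j
    & forall C u v e, C \in clusters X -> [set u; v] \in tedges X C ->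
        e < m -> slot name s e u v ->
        exists2 j, j < s' 5 0 & s' 6 j = lab C /\ s' 7 j = e].

(* Array 4 flags the edge slots of H. *)
Definition pram_encodes_edges (m : nat) (G : sgraph) (name : G -> nat)
    (s s' : store) (H : {set {set G}}) : Prop :=
  forall e u v, e < m -> slot name s e u v ->
    [set u; v] \in H <-> s' 4 e != 0.

Definition pram_clusters (R : realType) (n m T : nat) (W : R) (D : nat)
    (xi delta : R) (A : program) : Prop :=
  forall (G : sgraph) (name : G -> nat) (s : store), pram_input n m name s ->
    (1 - delta <= pr R (steps T (Config A s 0))
       (fun x => [/\ code x = [::], ((work x)%:R <= W)%R
          & exists X : clustering G, weak_diam_clustering 3 D xi X /\
              pram_encodes_clustering m name s (memory x) X]))%R.

Definition pram_spans (R : realType) (n m T : nat) (W : R) (beta : nat)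
    (sz delta : R) (A : program) : Prop :=
  forall (G : sgraph) (name : G -> nat) (s : store), pram_input n m name s ->
    (1 - delta <= pr R (steps T (Config A s 0))
       (fun x => [/\ code x = [::], ((work x)%:R <= W)%R
          & exists H : {set {set G}},
              [/\ is_spanner beta H, (#|H|%:R <= sz * #|G|%:R)%R
                & pram_encodes_edges m name s (memory x) H]]))%R.

Definition clusters_with (R : realType) (n D : nat) (xi delta : R)
    (A : forall G : sgraph, rnd (clustering G)) : Prop :=
  forall G : sgraph, #|G| <= n ->
    (1 - delta <= pr R (A G) (weak_diam_clustering 3 D xi))%R.

Definition spans_with (R : realType) (n beta : nat) (sz delta : R)
    (A : forall G : sgraph, rnd {set {set G}}) : Prop :=
  forall G : sgraph, #|G| <= n ->
    (1 - delta <= pr R (A G)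
       (fun H => is_spanner beta H /\ #|H|%:R <= sz * #|G|%:R))%R.

Notation lg := (trunc_log 2).

(* Main.v *)
Require Import Defs.
From mathcomp Require Import all_boot all_order all_algebra.
From mathcomp Require Import boolp reals.
From mathcomp Require Import zify lra.

(** Starting from the whole vertex set [S], repeatedly cluster the subgraph
    induced by [S], add to H all tree edges and, for every unclustered vertex of
    [S] next to a cluster, one edge to it, and then delete the clustered vertices
    from [S].  As clusters are 3-separated, a vertex is next to at most one
    cluster, so an edge losing an endpoint is bridged by at most [D + 1] edges of
    H.  As [S] is halved each time, [lg n + 1] phases suffice, and since
    [6 xi |S|] drops by at least the number [<= 3 xi |S|] of edges added,
    [|H| <= 6 xi |V|].  [D = 0] is impossible for [n > 2] because of the triangle,
    which also gives [xi >= 1/2].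

    In CONGEST the clustered vertices announce themselves with one bit; on a
    cluster graph the node that adds the joining edge of a fibre is elected along
    the fibre's tree.  Plain CONGEST is the case of singleton fibres. *)

Set Implicit Arguments.
Unset Strict Implicit.
Unset Printing Implicit Defensive.

Import Order.TTheory GRing.Theory Num.Theory.

(** * Stretch and size of one phase *)

(** The set on which [A] is rerun depends on earlier coins. Failure probabilities are therefore
    added by a union bound, which needs the guarantee of [A] for every [S] but no independence. If
    [1 <= delta] the claim is void; if [delta < 1] a successful run exists, and this is what turns a
    probabilistic guarantee on the triangle into inequalities about [D] and [xi].

    The obstacle in each machine model is to rerun [A] with unchanged parameters while the machine
    still holds the whole graph. A message-passing node cannot distinguish a silent neighbour from
    an absent one, so deleted nodes merely fall silent. On the PRAM the input format admits vacant
    slots, so deletion need not compact the edge list. What a phase must supply besides the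
    clustering is isolated in [joins], so stretch and size are argued once for all models. *)

Section Distances.
Context (V : finType) (e : rel V).

Lemma dist_le_refl u k : dist_le e u u k.
Proof. by exists [::]. Qed.

Lemma dist_le1 u v : e u v -> dist_le e u v 1.
Proof. by move=> euv; exists [:: v]; rewrite /= euv. Qed.

Lemma dist_le_leq u v k l : k <= l -> dist_le e u v k -> dist_le e u v l.
Proof. by move=> kl [p [pp pl ps]]; exists p; split=> //; apply: leq_trans kl. Qed.

Lemma dist_le_trans u v w k l :
  dist_le e u v k -> dist_le e v w l -> dist_le e u w (k + l).
Proof.
move=> [p [pp <- ps]] [q [qp <- qs]]; exists (p ++ q).
by rewrite cat_path pp qp last_cat size_cat leq_add.
Qed.

Lemma dist_le_sym u v k : symmetric e -> dist_le e u v k -> dist_le e v u k.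
Proof.
move=> esym [p [pp <- ps]]; exists (rev (belast u p)).
rewrite size_rev size_belast; split=> //.
  by rewrite rev_path (eq_path (e' := e)) // => x y; rewrite esym.
by case: p {pp ps} => //= x p; rewrite rev_cons last_rcons.
Qed.

End Distances.

Lemma dist_le_map (V V' : finType) (e : rel V) (e' : rel V') (f : V -> V') u v k :
  (forall x y, e x y -> e' (f x) (f y)) ->
  dist_le e u v k -> dist_le e' (f u) (f v) k.
Proof.
move=> ee' [p [pp <- ps]]; exists (map f p); rewrite size_map last_map; split=> //.
by rewrite path_map; apply: sub_path pp.
Qed.

Lemma dist_le_dilate (V : finType) (e e' : rel V) m u v k :
  (forall x y, e x y -> dist_le e' x y m) ->
  dist_le e u v k -> dist_le e' u v (m * k).
Proof.
move=> ee' [p [+ <- +]]; elim: p u k => [|x p IH] u k /=.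
  by move=> *; apply: dist_le_refl.
case/andP=> eux pp; case: k => // k ps; rewrite mulnS.
exact: dist_le_trans (ee' _ _ eux) (IH _ _ pp ps).
Qed.

Lemma erel_sym (V : finType) (F : {set {set V}}) : symmetric (erel F).
Proof. by move=> u v; rewrite /erel setUC. Qed.

Lemma set2_inj (T : finType) (a b c d : T) : [set a; b] = [set c; d] ->
  (a = c /\ b = d) \/ (a = d /\ b = c).
Proof.
move=> E; have := set21 a b; have := set22 a b; rewrite E !inE.
have := set21 c d; have := set22 c d; rewrite -E !inE {E}.
by do 4! (case/orP => /eqP ?); subst; auto.
Qed.

Lemma mem_edges (G : sgraph) (u v : G) : ([set u; v] \in edges G) = adj u v.
Proof.
apply/imsetP/idP => [[[a b]]|uv]; last by exists (u, v); rewrite ?inE.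
by rewrite inE /= => ab /set2_inj[] [-> ->]; rewrite // adj_sym.
Qed.

Lemma edgesP (G : sgraph) (f : {set G}) :
  f \in edges G -> exists u v, adj u v /\ f = [set u; v].
Proof. by case/imsetP=> -[u v]; rewrite inE /= => uv ->; exists u, v. Qed.

(** * Edge count of forests *)

Section Forest.
Context (V : finType) (F : {set {set V}}) (U : {set V}).
Hypothesis irr : irreflexive (erel F).
Hypothesis FU : {in F, forall f : {set V}, f \subset U}.
Hypothesis acyclic : forall p : seq V, ucycle (erel F) p -> size p <= 2.

(* A simple path that cannot be extended at its head starts at a leaf. *)
Lemma forest_leaf : U != set0 ->
  exists2 x, x \in U & forall y z, erel F x y -> erel F x z -> y = z.
Proof.
case/set0Pn=> x0 x0U.
suff leaf k x p : #|V| - size p <= k -> x \in U -> uniq (x :: p) -> path (erel F) x p ->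
    exists2 x, x \in U & forall y z, erel F x y -> erel F x z -> y = z.
  by apply: (leaf #|V| x0 [::]); rewrite // leq_subr.
elim: k x p => [|k IH] x p szp xU up pp.
  have := max_card (mem (x :: p)); rewrite (card_uniqP up) /=.
  by rewrite ltnNge -subn_eq0 -leqn0 szp.
have [[w /andP[xw wp]]|nw] := pselect (exists w, erel F x w && (w \notin x :: p)).
  apply: (IH w (x :: p)) => //=; first by rewrite leq_subLR addSnnS -leq_subLR.
  - by have /subsetP := FU xw; apply; rewrite set22.
  - by move: up => /= ->; rewrite andbT.
  - by rewrite erel_sym xw.
exists x => // y z xy xz.
(* Every neighbour of [x] lies on the path; one beyond the first vertex [h] would close a cycle
   [x, h, ..., w] of length at least 3. *)
have nbr w : erel F x w -> w = head x p.
  move=> xw; have: w \in x :: p by apply: contrapT => /negP wp; apply: nw; exists w; rewrite xw.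
  rewrite inE; case/orP => [/eqP wx|]; first by rewrite wx irr in xw.
  case: p up pp {szp nw} => // h q up pp; rewrite inE => /orP[/eqP //|wq].
  case/splitPr: wq up pp => q1 q2 up pp.
  have := @acyclic (x :: h :: rcons q1 w); rewrite /ucycle /= size_rcons.
  move: up pp; rewrite -cat_rcons -!cat_cons cat_uniq cat_path /= => /andP[-> _].
  case/andP=> /andP[-> pq] _; rewrite rcons_path pq last_rcons erel_sym xw.
  by move/(_ isT).
by rewrite (nbr y) // (nbr z).
Qed.

End Forest.

(** Deleting a leaf costs one vertex and at most one edge. The bound is one weaker than the sharp
    one, which lets the induction start at an empty [U]. *)
Lemma card_forest (V : finType) (F : {set {set V}}) (U : {set V}) :
  irreflexive (erel F) ->
  {in F, forall f : {set V}, f \subset U /\ exists u v, f = [set u; v]} ->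
  (forall p : seq V, ucycle (erel F) p -> size p <= 2) ->
  #|F| <= #|U|.
Proof.
elim: {U}#|U| {-2}U (leqnn #|U|) F => [|k IH] U Uk F irr FU acy.
  move: Uk; rewrite leqn0 cards_eq0 => /eqP U0; rewrite U0 cards0 leqn0 cards_eq0.
  apply/eqP/setP => f; rewrite inE; apply/negP => fF.
  have [/subsetP fU [u [v Ef]]] := FU _ fF.
  by have := fU u; rewrite U0 Ef set21 inE => /(_ isT).
have [U0|U0] := eqVneq U set0; first by apply: IH; rewrite ?U0 ?cards0 -?U0.
have [x xU leaf] := forest_leaf irr (fun f fF => proj1 (FU f fF)) acy U0.
pose F' := [set f in F | x \notin f].
have sF' : {subset F' <= F} by move=> f; rewrite inE => /andP[].
have F'U : #|F'| <= #|U :\ x|.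
  apply: IH; first by move: Uk; rewrite (cardsD1 x U) xU.
  - by move=> u; apply/negP => /sF'; apply/negP; rewrite -[_ \in _]/(erel F u u) irr.
  - move=> f fF'; have [fU fE] := FU _ (sF' _ fF'); split=> //.
    by rewrite subsetD1 fU; move: fF'; rewrite inE => /andP[].
  - move=> p /andP[cp up]; apply: acy; apply/andP; split=> //.
    by apply: sub_cycle cp => u v; apply: sF'.
rewrite (cardsD1 x U) xU -(cardsID F' F) addnC leq_add //; last first.
  by apply: leq_trans F'U; apply: subset_leq_card; apply: subsetIr.
have star f : f \in F :\: F' -> exists2 y, erel F x y & f = [set x; y].
  rewrite !inE => /andP[+ fF]; rewrite fF /= negbK => xf.
  have [_ [u [v Ef]]] := FU _ fF; move: xf; rewrite Ef !inE => /orP[] /eqP->.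
    by exists v; rewrite // /erel -Ef.
  by exists u; [rewrite erel_sym /erel -Ef | rewrite setUC].
rewrite leqNgt; apply/negP => /card_gt1P[f [g [/star[y xy ->] /star[z xz ->]]]].
by rewrite (leaf _ _ xy xz) eqxx.
Qed.

Lemma card_tree (G : sgraph) (U : {set G}) (F : {set {set G}}) :
  is_tree U F -> #|F| <= #|U|.
Proof.
case=> FE FU _ _ acy; apply: card_forest => //.
  by move=> u; apply/negP => /(subsetP FE); rewrite mem_edges adj_irr.
move=> f fF; split; first exact: FU.
by have [u [v [_ ->]]] := edgesP (subsetP FE _ fF); exists u, v.
Qed.

Lemma sum_overlap (G : sgraph) (X : clustering G) :
  \sum_(v : G) overlap X v = \sum_(C in clusters X) #|tverts X C|.
Proof.
under eq_bigr => v _ do rewrite /overlap -sum1dep_card big_mkcondr.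
rewrite exchange_big /=; apply: eq_bigr => C _.
by rewrite -big_mkcondr /= sum1dep_card cardE /= -cardE; apply: eq_card => v; rewrite !inE.
Qed.

(** Half of the vertices are covered, so this bounds the number of vertices, and with it the number
    of joining edges, by twice the total overlap. *)
Lemma cover_leq_overlap (G : sgraph) (X : clustering G) :
  {in clusters X, forall C : {set G}, C \subset tverts X C} ->
  #|cover (clusters X)| <= \sum_(v : G) overlap X v.
Proof.
move=> CT; rewrite sum_overlap; apply: leq_trans (leq_card_cover _) _.
by apply: leq_sum => C /CT; apply: subset_leq_card.
Qed.

(** * Induced subgraphs *)

Section InducedSubgraph.
Context (G : sgraph) (P : pred G).

Definition induced_adj : rel {v : G | P v} := fun u v => adj (val u) (val v).

Lemma induced_adj_sym : symmetric induced_adj.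
Proof. by move=> u v; apply: adj_sym. Qed.

Lemma induced_adj_irr : irreflexive induced_adj.
Proof. by move=> u; apply: adj_irr. Qed.

Definition induced : sgraph := SGraph induced_adj_sym induced_adj_irr.

End InducedSubgraph.

Definition induced_set (G : sgraph) (S : {set G}) : sgraph := induced (fun v => v \in S).

(** * Invariant of the phases *)

Section Phase.
Context (R : realType) (G : sgraph).

Definition spanner_inv (D : nat) (xi : R) (S : {set G}) (H : {set {set G}}) : Prop :=
  [/\ H \subset edges G,
      forall u v : G, adj u v -> ~~ ((u \in S) && (v \in S)) ->
        dist_le (erel H) u v D.+1
    & (#|H|%:R + 6 * xi * #|S|%:R <= 6 * xi * #|G|%:R)%R].

Lemma spanner_inv0 D xi : spanner_inv D xi [set: G] set0.
Proof.
split; first exact: sub0set.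
- by move=> u v _; rewrite !inE.
- by rewrite cards0 cardsT add0r.
Qed.

Lemma spanner_inv_spanner D xi H : spanner_inv D xi set0 H -> is_spanner D.+1 H.
Proof.
case=> HE dil _; split=> // u v k; apply: dist_le_dilate => x y xy.
by apply: dil => //; rewrite inE.
Qed.

Variable S : {set G}.
Let GS := induced_set S.

Definition lift_set (C : {set GS}) : {set G} := [set val v | v in C].

Definition clustered (X : clustering GS) : {set G} := lift_set (cover (clusters X)).

Definition forest_edges (X : clustering GS) : {set {set G}} :=
  \bigcup_(C in clusters X) [set lift_set f | f in tedges X C].

(** The interface shared by [nearest_joins], [fibre_joins] and [slot_joins]. The edge of [u] may
    lead to some [w'] other than [w], which leaves each model free to choose: by separation both lie
    in the same cluster. *)
Definition joins (X : clustering GS) (J : {set {set G}}) : Prop :=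
  [/\ J \subset edges G, #|J| <= #|S|
    & forall u w, u \in S :\: clustered X -> w \in clustered X -> adj u w ->
        exists w', [/\ w' \in clustered X, adj u w' & [set u; w'] \in J]].

Lemma lift_set2 (u v : GS) : lift_set [set u; v] = [set val u; val v].
Proof. by rewrite /lift_set imsetU1 imset_set1. Qed.

Lemma card_induced_set : #|GS| = #|S|.
Proof. by rewrite card_sig; apply: eq_card. Qed.

Lemma card_clustered X : #|clustered X| = #|cover (clusters X)|.
Proof. exact: card_imset val_inj. Qed.

Lemma clustered_sub X : clustered X \subset S.
Proof. by apply/subsetP => _ /imsetP[v _ ->]; apply: (valP v). Qed.

Lemma clusteredP (X : clustering GS) u : u \in clustered X ->
  exists C (u' : GS), [/\ C \in clusters X, u' \in C & u = val u'].
Proof. by case/imsetP=> u' /bigcupP[C CX u'C] ->; exists C, u'. Qed.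

Lemma forest_edges_sub (X : clustering GS) :
  {in clusters X, forall C, is_tree (tverts X C) (tedges X C)} ->
  forest_edges X \subset edges G.
Proof.
move=> tX; apply/bigcupsP => C CX; apply/subsetP => _ /imsetP[f fC ->].
have [/subsetP FE _ _ _ _] := tX _ CX.
by have [u [v [uv ->]]] := edgesP (FE _ fC); rewrite lift_set2 mem_edges.
Qed.

Lemma card_tree_edges (X : clustering GS) :
  {in clusters X, forall C, is_tree (tverts X C) (tedges X C)} ->
  \sum_(C in clusters X) #|tedges X C| <= \sum_(v : GS) overlap X v.
Proof.
by move=> tX; rewrite sum_overlap; apply: leq_sum => C /tX/card_tree.
Qed.

Lemma card_forest_edges (X : clustering GS) :
  {in clusters X, forall C, is_tree (tverts X C) (tedges X C)} ->
  #|forest_edges X| <= \sum_(v : GS) overlap X v.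
Proof.
move=> tX; apply: leq_trans (card_tree_edges tX).
rewrite /forest_edges; elim/big_rec2: _ => [|C m A _ IH]; first by rewrite cards0.
rewrite (leq_trans (leq_card_setU _ _)) // leq_add // leq_imset_card //.
Qed.

Lemma phase_spanner_inv D xi H X J :
  spanner_inv D xi S H -> weak_diam_clustering 3 D xi X -> joins X J ->
  spanner_inv D xi (S :\: clustered X) (H :|: forest_edges X :|: J).
Proof.
move=> [HE dil szH] [tI tX sep half ov] [JE szJ Jjoin].
have trees : {in clusters X, forall C, is_tree (tverts X C) (tedges X C)}.
  by move=> C /tX[].
have in_cluster C (u v : GS) : C \in clusters X -> u \in C -> v \in C ->
    dist_le (erel (H :|: forest_edges X :|: J)) (val u) (val v) D.
  move=> CX uC vC; have [_ /subsetP CT diam] := tX _ CX.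
  apply: dist_le_map (diam _ _ (CT _ uC) (CT _ vC)) => x y xy.
  rewrite /erel !inE; apply/orP; left; apply/orP; right.
  by apply/bigcupP; exists C => //; rewrite -lift_set2 imset_f.
have same C1 C2 (u v : GS) k : C1 \in clusters X -> C2 \in clusters X ->
    u \in C1 -> v \in C2 -> dist_le (@adj GS) u v k -> k < 3 -> C1 = C2.
  move=> C1X C2X uC vC duv k3; apply: contrapT => /eqP C12.
  by have := sep _ _ C1X C2X C12 _ _ uC vC _ duv; rewrite leqNgt k3.
split.
- by rewrite !subUset HE JE forest_edges_sub.
- suff one u v : adj u v -> u \in clustered X -> v \in S ->
      dist_le (erel (H :|: forest_edges X :|: J)) u v D.+1.
    move=> u v uv; have [|nS] := boolP ((u \in S) && (v \in S)).
      case/andP=> uS vS; rewrite !inE uS vS !andbT negb_and !negbK.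
      case/orP => [uX|vX]; first exact: one.
      by apply: dist_le_sym; [exact: erel_sym | apply: one; rewrite // adj_sym].
    move=> _; apply: (@dist_le_map _ _ (erel H) _ id) (dil _ _ uv nS) => x y.
    by rewrite /erel !inE => ->.
  move=> uv uX vS; have [C [u' [CX u'C Eu]]] := clusteredP uX.
  have [vX|vX] := boolP (v \in clustered X).
    have [C' [v' [C'X v'C Ev]]] := clusteredP vX.
    have CC' : C = C'.
      apply: (same _ _ u' v' 1) => //.
      by apply: dist_le1; rewrite /= /induced_adj -Eu -Ev.
    by apply: dist_le_leq (leqnSn D) _; rewrite Eu Ev; apply: in_cluster CX _ _; rewrite // CC'.
  have vS' : v \in S :\: clustered X by rewrite inE vX.
  have vu : adj v u by rewrite adj_sym.
  have [w [wX vw wJ]] := Jjoin v u vS' uX vu.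
  have [C' [w' [C'X w'C Ew]]] := clusteredP wX.
  (* [u] and [w] are at distance at most 2 through [v]. This path stays inside [S], as it must:
     separation is known only for distances in the induced subgraph. *)
  have CC' : C = C'.
    apply: (same _ _ u' w' 2) => //; apply: (@dist_le_trans _ _ _ (exist _ v vS) _ 1 1);
      by apply: dist_le1; rewrite /= /induced_adj -?Eu -?Ew.
  rewrite -addn1; apply: (@dist_le_trans _ _ _ w).
    by rewrite Eu Ew; apply: in_cluster CX _ _; rewrite // CC'.
  by apply: dist_le1; rewrite erel_sym /erel inE wJ orbT.
- have szF := card_forest_edges trees.
  have ovC := cover_leq_overlap (fun C CX => let: And3 _ h _ := tX C CX in h).
  move: half ovC; rewrite -card_clustered card_induced_set => half ovC.
  have szHFJ : #|H :|: forest_edges X :|: J| <=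
      #|H| + \sum_(v : GS) overlap X v + #|S|.
    apply: leq_trans (leq_card_setU _ _) _; apply: leq_add szJ.
    by apply: leq_trans (leq_card_setU _ _) _; rewrite leq_add2l.
  have szS' : #|S :\: clustered X| + #|clustered X| = #|S|.
    by rewrite addnC -(cardsID (clustered X) S) (setIidPr (clustered_sub X)).
  move: ov; rewrite card_induced_set.
  move: szHFJ szS' half ovC szH {szJ szF}.
  move: (\sum_v overlap X v) => o; move: (#|H :|: forest_edges X :|: J|) => h'.
  move: #|H| #|S| #|S :\: _| #|clustered X| => h s s' c h'le ss' half co szH ov.
  have E1 : (h'%:R <= h%:R + o%:R + s%:R :> R)%R by rewrite -!natrD ler_nat.
  have E2 : (s%:R <= 2 * c%:R :> R)%R by rewrite -natrM ler_nat.
  have E3 : (c%:R <= o%:R :> R)%R by rewrite ler_nat.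
  have E4 : (2 * s'%:R <= s%:R :> R)%R by rewrite -natrM ler_nat; lia.
  (* For empty [S] the sign of [xi] is unknown, but then the overlap vanishes too and no edge is
     added. *)
  have [s0|s0] := posnP s.
    have -> : s' = 0 by lia.
    by move: E1 E3 ov szH; rewrite s0; lra.
  have xi0 : (0 <= xi)%R.
    have : (0 <= s%:R * xi)%R by apply: le_trans ov; apply: ler0n.
    by rewrite pmulr_rge0 // ltr0n.
  have E5 : (2 * (xi * s'%:R) <= xi * s%:R)%R by rewrite mulrCA ler_wpM2l.
  have E6 : (s%:R * xi = xi * s%:R)%R by rewrite mulrC.
  lra.
Qed.

(** Sizes are measured by strict powers of two so that the bound at exponent 0 says that no vertex
    is left. *)
Lemma card_unclustered (X : clustering GS) k :
  #|GS| <= 2 * #|cover (clusters X)| -> #|S| < 2 ^ k.+1 ->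
  #|S :\: clustered X| < 2 ^ k.
Proof.
rewrite card_induced_set -card_clustered.
have := cardsID (clustered X) S; rewrite (setIidPr (clustered_sub X)).
rewrite expnS; lia.
Qed.

End Phase.

(** * The triangle *)

Definition K3_adj : rel 'I_3 := fun i j => i != j.

Lemma K3_adj_sym : symmetric K3_adj.
Proof. by move=> i j; rewrite /K3_adj eq_sym. Qed.

Lemma K3_adj_irr : irreflexive K3_adj.
Proof. by move=> i; rewrite /K3_adj eqxx. Qed.

Definition K3 : sgraph := SGraph K3_adj_sym K3_adj_irr.

(* In a triangle all clusters coincide and must have two vertices. *)
Lemma K3_clustering (R : realType) (D : nat) (xi : R) (X : clustering K3) :
  weak_diam_clustering 3 D xi X -> 0 < D /\ (1 <= 2 * xi)%R.
Proof.
case=> _ tX sep; rewrite card_ord => half ov.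
have ovC := cover_leq_overlap (fun C CX => let: And3 _ h _ := tX C CX in h).
split; last first.
  have : (2%:R <= 3%:R * xi)%R by apply: le_trans ov; rewrite ler_nat; lia.
  by lra.
have : 1 < #|cover (clusters X)| by lia.
case/card_gt1P => a [b [/bigcupP[C CX aC] /bigcupP[C' C'X bC'] ab]].
have CC' : C = C'.
  apply: contrapT => /eqP CC'.
  by have := sep _ _ CX C'X CC' _ _ aC bC' 1 (dist_le1 (ab : @adj K3 a b)).
rewrite -CC' in bC'; have [_ /subsetP CT diam] := tX _ CX.
have [[|c p] [_ /= E +]] := diam _ _ (CT _ aC) (CT _ bC'); last by case: D {tX diam}.
by rewrite E eqxx in ab.
Qed.

(** * Randomness and the model-free construction *)

Section Randomness.
Context (R : realType).
Local Open Scope ring_scope.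

Lemma bind_ret (A B : Type) (a : A) (f : A -> rnd B) : bind (Ret a) f = f a.
Proof. by []. Qed.

Lemma bindA (A B C : Type) (x : rnd A) (f : A -> rnd B) (g : B -> rnd C) :
  bind (bind x f) g = bind x (fun a => bind (f a) g).
Proof. by elim: x => //= k IH; congr Coin; apply: funext => b; apply: IH. Qed.

Lemma coinless_bind (A B : Type) (x : rnd A) (f : A -> rnd B) :
  coinless x -> (forall a, coinless (f a)) -> coinless (bind x f).
Proof. by move=> [a ->] cf; apply: cf. Qed.

Lemma pr_ge0 (A : Type) (x : rnd A) P : 0 <= pr R x P.
Proof.
elim: x => [a|k IH] /=; first exact: ler0n.
by have := IH true; have := IH false; lra.
Qed.

Lemma pr_le1 (A : Type) (x : rnd A) P : pr R x P <= 1.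
Proof.
elim: x => [a|k IH] /=; first by case: asbool.
by have := IH true; have := IH false; lra.
Qed.

Lemma pr_mono (A : Type) (x : rnd A) (P Q : A -> Prop) :
  (forall a, P a -> Q a) -> pr R x P <= pr R x Q.
Proof.
move=> PQ; elim: x => [a|k IH] /=; last by have := IH true; have := IH false; lra.
have [/PQ Qa|nPa] := pselect (P a); last by rewrite (asboolF nPa) ler0n.
by rewrite (asboolT Qa); case: asbool.
Qed.

Lemma pr_bind_le (A B C : Type) (x : rnd A) (f : A -> rnd B) (g : A -> rnd C) P Q d :
  (forall a, pr R (f a) P - d <= pr R (g a) Q) ->
  pr R (bind x f) P - d <= pr R (bind x g) Q.
Proof.
by move=> fg; elim: x => [a|k IH] //=; have := IH true; have := IH false; lra.
Qed.

(** The union bound: failure probabilities of consecutive stages add up, the second bound being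
    uniform over the successful outcomes of the first. *)
Lemma pr_bind (A B : Type) (x : rnd A) (f : A -> rnd B) (P : A -> Prop) Q d d' :
  0 <= d' -> 1 - d <= pr R x P -> (forall a, P a -> 1 - d' <= pr R (f a) Q) ->
  1 - (d + d') <= pr R (bind x f) Q.
Proof.
move=> d'0 + fQ; suff : pr R x P - d' <= pr R (bind x f) Q by lra.
elim: x => [a|k IH] /=; last by have := IH true; have := IH false; lra.
have := pr_ge0 (f a) Q; case: asboolP => [/fQ|_]; last by rewrite mulr0n; lra.
by rewrite mulr1n; lra.
Qed.

Lemma pr_false (A : Type) (x : rnd A) (P : A -> Prop) d :
  (forall a, ~ P a) -> 1 - d <= pr R x P -> 1 <= d.
Proof.
move=> nP; suff -> : pr R x P = 0 by lra.
elim: x => [a|k IH] /=; first by rewrite asboolF.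
by rewrite !IH addr0 mul0r.
Qed.

Lemma pr_ge_delta (A : Type) (x : rnd A) (P : A -> Prop) d :
  1 - d <= pr R x P -> 0 <= d.
Proof. by have := pr_le1 x P; lra. Qed.

(** Extracts a single good outcome. Applied to runs on the triangle, it makes [K3_clustering]
    available. *)
Lemma pr_sat (A : Type) (x : rnd A) (P : A -> Prop) d :
  1 - d <= pr R x P -> d < 1 -> exists a, P a.
Proof.
move=> xP d1; apply: contrapT => nP; suff : 1 <= d by lra.
by apply: pr_false xP => a Pa; apply: nP; exists a.
Qed.

Lemma pr_bind_ret (A B : Type) (x : rnd A) (f : A -> B) P :
  pr R (bind x (fun a => Ret (f a))) P = pr R x (fun a => P (f a)).
Proof. by elim: x => [a|k IH] //=; rewrite !IH. Qed.

End Randomness.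

Lemma lgS_leq n : 1 < n -> (lg n).+1 <= 2 * lg n.
Proof.
move=> n1; have : 0 < lg n by rewrite trunc_log_gt0 n1.
lia.
Qed.

Lemma pr_slack (R : realType) (A : Type) (x : rnd A) (P Q : A -> Prop) (K k : nat) (d : R) :
  (0 <= d)%R -> k <= K -> (forall a, P a -> Q a) ->
  (1 - k%:R * d <= pr R x P -> 1 - K%:R * d <= pr R x Q)%R.
Proof.
move=> d0 kK PQ xP; apply: le_trans (pr_mono _ x PQ); apply: le_trans xP.
by rewrite lerD2l lerN2 ler_wpM2r // ler_nat.
Qed.

(** * Stretch and size at the end of the phases *)

Section FinalBounds.
Context (R : realType) (G : sgraph) (K D : nat) (xi : R).

(* [xi] may be negative, but only when [G] is empty. *)
Lemma spanner_inv_final (H : {set {set G}}) :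
  6 <= K -> 0 < D \/ #|G| <= 1 -> spanner_inv D xi set0 H ->
  is_spanner (K * D) H /\ (#|H|%:R <= K%:R * xi * #|G|%:R)%R.
Proof.
move=> K6 D0 inv; split.
  have [HE span] := spanner_inv_spanner inv; split=> // u v k duv.
  case: D0 => [D0|G1]; last first.
    by rewrite (card_le1_eqP G1 u v) //; apply: dist_le_refl.
  (* [D + 1 <= 2 * D] is where [0 < D] enters. *)
  apply: dist_le_leq (span _ _ _ duv); rewrite leq_mul2r; apply/orP; right.
  by apply: leq_trans (_ : 2 * D <= _); [lia | rewrite leq_mul2r (leq_trans _ K6) ?orbT].
case: inv => _ _; rewrite cards0 mulr0 addr0 => szH; apply: (le_trans szH).
have xG : (0 <= xi * #|G|%:R)%R.
  have : (0 <= 6 * xi * #|G|%:R)%R by apply: le_trans szH.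
  by rewrite -mulrA pmulr_rge0.
by rewrite -!mulrA ler_wpM2r // ler_nat.
Qed.

End FinalBounds.

Section NoModel.
Context (R : realType) (A : forall G : sgraph, rnd (clustering G)).

Definition nearest_joins (G : sgraph) (S : {set G}) (X : clustering (induced_set S)) :
    {set {set G}} :=
  [set [set u; odflt u [pick w in clustered X | adj u w]] |
    u in [set u in S | [exists w in clustered X, adj u w]]].

Lemma nearest_joinsP (G : sgraph) (S : {set G}) (X : clustering (induced_set S)) :
  joins X (nearest_joins X).
Proof.
have pickP' u w : w \in clustered X -> adj u w ->
    exists w', [/\ w' \in clustered X, adj u w' & [pick w in clustered X | adj u w] = Some w'].
  move=> wX uw; case: pickP => [w' /andP[]|/(_ w)]; last by rewrite wX uw.
  by move=> w'X uw'; exists w'.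
split.
- apply/subsetP => _ /imsetP[u + ->]; rewrite inE => /andP[_ /existsP[w /andP[wX uw]]].
  by have [w' [_ uw' ->]] := pickP' _ _ wX uw; rewrite mem_edges.
- apply: leq_trans (leq_imset_card _ _) _; apply: subset_leq_card.
  by apply/subsetP => u; rewrite inE => /andP[].
- move=> u w; rewrite inE => /andP[_ uS] wX uw.
  have [w' [w'X uw' E]] := pickP' _ _ wX uw; exists w'; split=> //.
  apply/imsetP; exists u; last by rewrite E.
  by rewrite inE uS; apply/existsP; exists w; rewrite wX.
Qed.

Fixpoint build (G : sgraph) (k : nat) (S : {set G}) (H : {set {set G}}) : rnd {set {set G}} :=
  if k is k'.+1 then
    bind (A (induced_set S)) (fun X =>
      build k' (S :\: clustered X) (H :|: forest_edges X :|: nearest_joins X))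
  else Ret H.

Lemma build_coinless G k S H : (forall G, coinless (A G)) -> coinless (@build G k S H).
Proof.
move=> detA; elim: k S H => [|k IH] S H /=; first by exists H.
exact: coinless_bind.
Qed.

Lemma buildP n D (xi delta : R) (G : sgraph) k (S : {set G}) H :
  clusters_with n D xi delta A -> (0 <= delta)%R -> #|G| <= n ->
  #|S| < 2 ^ k -> spanner_inv D xi S H ->
  (1 - k%:R * delta <= pr R (build k S H) (spanner_inv D xi set0))%R.
Proof.
move=> AP d0 Gn; elim: k S H => [|k IH] S H Sk inv /=.
  have S0 : S = set0 by apply/eqP; rewrite -cards_eq0 -leqn0 -ltnS -(expn0 2).
  by rewrite asboolT -?S0 // mul0r subr0.
rewrite -nat1r mulrDl mul1r.
apply: (@pr_bind _ _ _ _ _ (weak_diam_clustering 3 D xi)).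
- by rewrite mulr_ge0.
- by apply: AP; rewrite card_induced_set (leq_trans (max_card _)).
- move=> X XP; apply: IH.
    by apply: card_unclustered Sk; case: XP.
  by apply: phase_spanner_inv => //; apply: nearest_joinsP.
Qed.

End NoModel.

Lemma pr_trivial (R : realType) (A : Type) (x : rnd A) P (k : nat) (d : R) :
  0 < k -> (1 <= d)%R -> (1 - k%:R * d <= pr R x P)%R.
Proof.
move=> k0 d1; apply: le_trans (pr_ge0 _ _ _); rewrite subr_le0.
by apply: (le_trans d1); rewrite ler_peMl ?ler1n // (le_trans ler01).
Qed.

Lemma spanner_without_model (R : realType) (K : nat) (D : nat -> nat) (xi delta : nat -> R)
    (A : nat -> forall G : sgraph, rnd (clustering G)) :
  6 <= K ->
  (forall n, clusters_with n (D n) (xi n) (delta n) (A n)) ->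
  exists A' : nat -> forall G : sgraph, rnd {set {set G}},
    (forall n, 2 < n ->
       spans_with n (K * D n) (K%:R * xi n)%R
         ((K * lg n)%:R * delta n)%R (A' n)) /\
    ((forall n G, coinless (A n G)) -> forall n G, coinless (A' n G)).
Proof.
move=> K6 AP; exists (fun n (G : sgraph) => build (A n) (lg n).+1 [set: G] set0); split; last first.
  by move=> detA n G; apply: build_coinless.
move=> n n2 G Gn.
(* [A n] serves every graph with at most [n] vertices, so for [2 < n] its behaviour on the triangle
   constrains [D n]. *)
have AK3 := AP n K3; rewrite card_ord in AK3; have {}AK3 := AK3 n2.
have lg0 : 0 < lg n by rewrite trunc_log_gt0 (ltnW n2).
have [d1|d1] := leP 1%R (delta n).
  by apply: pr_trivial => //; rewrite muln_gt0 lg0 (leq_trans _ K6).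
have [X /K3_clustering[D0 _]] := pr_sat AK3 d1.
have d0 := pr_ge_delta AK3.
apply: (pr_slack d0 _ _ (buildP (AP n) d0 Gn _ (spanner_inv0 _ _ _))).
- by apply: leq_trans (lgS_leq (ltnW n2)) _; rewrite leq_mul2r (leq_trans _ K6) ?orbT.
- by move=> H; apply: spanner_inv_final => //; left.
- by rewrite cardsT (leq_ltn_trans Gn) // trunc_log_ltn.
Qed.

(** * CONGEST *)

Lemma encodes_edgesU (G Q : sgraph) (id : G -> nat) (proj : G -> Q) m1 m2 F1 F2 :
  encodes_edges id proj m1 F1 -> encodes_edges id proj m2 F2 ->
  encodes_edges id proj (fun v => m1 v ++ m2 v) (F1 :|: F2).
Proof.
move=> [s1 e1] [s2 e2]; split=> [u k|x y].
  rewrite mem_cat => /orP[/s1|/s2] [v [uv <- vu]]; exists v; rewrite mem_cat vu ?orbT //.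
rewrite inE; split.
  case/orP => [/e1|/e2] [u [v [<- <- uv]]]; exists u, v; rewrite mem_cat uv ?orbT //.
case=> u [v [ux vy]]; rewrite mem_cat => uv; apply/orP.
by case/orP: uv => uv; [left; apply/e1 | right; apply/e2]; exists u, v.
Qed.

(** [compute_all] tosses coins in the order of [enum]. As the induced graph inherits the order of
    [G], a simulated round tosses the same coins in the same order, and [compute_run] can be an
    equality of random computations. *)
Lemma enum_induced (G : sgraph) (P : pred G) :
  enum (induced P) = pmap insub (enum G) :> seq {v | P v}.
Proof.
by rewrite !enumT {1}unlock.
Qed.

Section Execution.
Context (In Out : Type) (P : protocol In Out) (G : sgraph) (id : G -> nat).
Hypothesis id_inj : injective id.

Lemma rounds_add a b (st : G -> state P) :
  rounds id (a + b) st = bind (rounds id a st) (rounds id b).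
Proof. by elim: a st => //= a IH st; rewrite bindA; congr bind; apply: funext. Qed.

Lemma rounds1 (st : G -> state P) : rounds id 1 st = round id st.
Proof.
by rewrite /= /round bindA; congr bind; apply: funext => st'.
Qed.

Lemma rounds_ret a b (st st' : G -> state P) :
  rounds id a st = Ret st' -> rounds id (a + b) st = rounds id b st'.
Proof. by rewrite rounds_add => ->. Qed.

Lemma inboxE (st : G -> state P) u v : adj v u -> inbox id st v (id u) = send (st u) (id v).
Proof.
move=> vu; rewrite /inbox; case: pickP => [w /andP[_ /eqP/id_inj->] //|/(_ u)].
by rewrite vu eqxx.
Qed.

Lemma round_det (st : G -> state P) : (forall v, compute (st v) = Ret (st v)) ->
  round id st = Ret (fun v => recv (st v) (inbox id st v)).
Proof.
move=> det; rewrite /round; suff -> : compute_all st = Ret st by [].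
rewrite /compute_all; elim: (enum G) => //= v l IH; rewrite det /=.
suff -> : upd st v (st v) = st by [].
by apply: funext => w; rewrite /upd; case: eqP => [->|].
Qed.

Definition nbrs (p : pred G) (v : G) : seq nat :=
  sort leq [seq id u | u <- enum (adj v) & p u].

Lemma nbrs_filter p (q : pred nat) v :
  [seq k <- nbrs p v | q k] = nbrs (fun u => p u && q (id u)) v.
Proof.
rewrite /nbrs filter_sort; [|exact: leq_total|exact: leq_trans].
rewrite filter_map -filter_predI; congr (sort _ (map _ _)).
by apply: eq_filter => u /=; rewrite andbC.
Qed.

Lemma mem_nbrs p v k :
  (k \in nbrs p v) <-> exists u, [/\ adj v u, p u & id u = k].
Proof.
rewrite /nbrs mem_sort; split.
  by case/mapP=> u; rewrite mem_filter mem_enum => /andP[pu vu] ->; exists u.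
by case=> u [vu pu <-]; apply: map_f; rewrite mem_filter pu mem_enum.
Qed.

Lemma eq_nbrs p q v : (forall u, adj v u -> p u = q u) -> nbrs p v = nbrs q v.
Proof.
move=> pq; rewrite /nbrs; congr (sort _ (map _ _)).
by apply: eq_in_filter => u; rewrite mem_enum; apply: pq.
Qed.

Lemma nbrsT v : nbrs xpredT v = nbr_ids id v.
Proof. by rewrite /nbrs filter_predT. Qed.

Lemma ohead_nbrs p v k : ohead (nbrs p v) = Some k ->
  exists u, [/\ adj v u, p u & id u = k].
Proof. by move=> h; apply/mem_nbrs; case: nbrs h => // a l [<-]; rewrite mem_head. Qed.

End Execution.

(** Sorting makes the list canonical: a node that filters its own neighbour list holds literally the
    input that [A] would get on the smaller network. *)
Lemma nbr_ids_induced (G : sgraph) (id : G -> nat) (P : pred G) (v : induced P) :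
  nbr_ids (fun u : induced P => id (val u)) v = nbrs id P (val v).
Proof.
rewrite /nbr_ids /nbrs; congr sort.
suff -> : [seq u <- enum (adj (val v)) | P u] = [seq val u | u <- enum (@adj (induced P) v)].
  by rewrite -map_comp.
have <- : [seq u <- [seq val u | u <- enum (induced P)] | adj (val v) u] =
    [seq val u | u <- enum (@adj (induced P) v)].
  rewrite filter_map /enum_mem -filter_predI; congr map.
  by apply: eq_filter => u; rewrite /= andbT.
rewrite enum_induced pmap_filter; last exact: insubK.
rewrite (eq_filter (isSome_insub _)) /enum_mem -!filter_predI.
by apply: eq_filter => u; rewrite /= andbT andbC.
Qed.

(** * The CONGEST protocol *)

Section SpannerProtocol.
Context (T r : nat) (A : protocol cg_input cl_out).

(* A phase consists of [T] rounds running [A], one round in which clustered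
   nodes announce themselves, and then [2 * r + 1] rounds counted by [Join]:
   - [r] rounds up the tree of each fibre: a node with a clustered neighbour,
     or one below which there is such a node, reports to its parent; [via] is
     the first identifier that reported, or one's own;
   - [r] rounds down: a token follows the [via] pointers from the centre;
   - the node where the token stops joins the cluster next to it.
   Arguments of [Join]: rounds done, input for the next phase, whether the node
   is clustered, identifiers of the clustered neighbours, [via], whether the
   token is present, marked edges.  [Dead] nodes were clustered earlier. *)
Inductive node :=
| Dead of seq nat
| Run of nat & cg_input & state A & seq nat
| Join of nat & cg_input & bool & seq nat & option nat & bool & seq nat.

(* The parent of a centre is arbitrary and may leave the network once
   vertices are deleted, so it is replaced by the centre itself. *)
Definition normalize (me : cg_input) : cg_input :=
  let: (inp, (c, p)) := me in (inp, (c, if inp.1 == c then inp.1 else p)).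

Definition selected (me : cg_input) (via : option nat) (tok : bool) : bool :=
  tok && (via == Some me.1.1).

Definition node_init (me : cg_input) : node :=
  Run 0 (normalize me) (init A (normalize me)) [::].

Definition node_compute (x : node) : rnd node :=
  if x is Run t me a mk then
    if t < T then bind (compute a) (fun a' => Ret (Run t me a' mk)) else Ret x
  else Ret x.

Definition node_send (x : node) (k : nat) : bitseq :=
  match x with
  | Dead _ => [::]
  | Run t _ a _ => if t < T then send a k else nseq (isSome (output a).1) true
  | Join t me _ cl via tok _ =>
      if t < r then nseq (isSome via && (k == me.2.2)) true
      else if t < r + r then nseq (tok && (via == Some k)) true
      else nseq (selected me via tok && (ohead cl == Some k)) true
  end.

(** After the announcement the silent nodes among the listed neighbours are those that remain. [via]
    is never overwritten, so its pointers lead back in time. A clustered node dies only in the last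
    round, because it still has to learn which of its edges were chosen for joining. *)
Definition node_recv (x : node) (m : nat -> bitseq) : node :=
  match x with
  | Dead _ => x
  | Run t me a mk =>
      if t < T then Run t.+1 me (recv a m) mk else
      let cl := [seq k <- me.1.2 | m k != [::]] in
      let c := isSome (output a).1 in
      Join 0 ((me.1.1, [seq k <- me.1.2 | m k == [::]]), me.2) c cl
        (if ~~ c && (cl != [::]) then Some me.1.1 else None) (me.1.1 == me.2.1)
        (mk ++ [seq a.2 | a <- (output a).2])
  | Join t me c cl via tok mk =>
      let got := [seq k <- me.1.2 | m k != [::]] in
      if t < r then
        Join t.+1 me c cl (if via is Some k then Some k else ohead got) tok mk
      else if t < r + r then Join t.+1 me c cl via (tok || (got != [::])) mk
      else
        let mk' := mk ++ (if selected me via tok then take 1 cl else [::]) ++ got in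
        if c then Dead mk' else Run 0 me (init A me) mk'
  end.

Definition node_output (x : node) : seq nat :=
  match x with Dead mk | Run _ _ _ mk | Join _ _ _ _ _ _ mk => mk end.

Definition spanner_protocol : protocol cg_input (seq nat) :=
  Protocol node_init node_compute node_send node_recv node_output.

Lemma spanner_protocol_bandwidth k : bandwidth A k -> 0 < k -> bandwidth spanner_protocol k.
Proof.
move=> bA k0 x u; have bit (b : bool) : size (nseq b true) <= k.
  by rewrite size_nseq; case: b.
case: x => [mk|t me a mk|t me c cl via tok mk] //=; first by case: ifP.
by do 2! [case: ifP => // _].
Qed.

Lemma spanner_protocol_det : congest_det A -> congest_det spanner_protocol.
Proof.
move=> dA [mk|t me a mk|t me c cl via tok mk] /=; try by eexists.
case: ifP => _; last by eexists.
by have [a' ->] := dA a; eexists.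
Qed.

Section Run.
Context (G : sgraph) (Q : cluster_graph r G) (id : G -> nat).
Hypothesis id_inj : injective id.
Let proj := cg_proj Q.
Let center := @cg_center _ _ Q.

Definition par (v : G) : G := if v == center (proj v) then v else cg_parent Q v.

Lemma par_proj v : proj (par v) = proj v.
Proof. by rewrite /par; case: ifPn => // /(@cg_parentP _ _ Q)[]. Qed.

Lemma par_adj v : par v != v -> adj v (par v).
Proof. by rewrite /par; case: ifPn => [|/(@cg_parentP _ _ Q)[] //]; rewrite eqxx. Qed.

(** The original pointers may pass through the centre and come back to it later; [par] stops at the
    first visit, so the depth can only shrink. *)
Lemma par_radius v : exists2 k, k <= r & iter k par v = center (proj v).
Proof.
have [k kr] := cg_radius Q v; rewrite -/center -/proj => E.
suff [k' k'k E'] : exists2 k', k' <= k & iter k' par v = center (proj v).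
  by exists k' => //; apply: leq_trans kr.
elim: k v E {kr} => [|k IH] v E; first by exists 0.
have [vc|vc] := eqVneq v (center (proj v)); first by exists 0.
have [_ pv] := cg_parentP vc.
have [|k' k'k E'] := IH (cg_parent Q v); first by rewrite -iterSr E /proj pv.
by exists k'.+1; rewrite // iterSr /par (negbTE vc) E' /proj pv.
Qed.

(** * Simulation of [A] on the remaining nodes *)

Section Live.
Variable S : {set Q}.

Definition live_net : sgraph := induced (fun v : G => proj v \in S).
Definition live_id (v : live_net) : nat := id (val v).
Definition live_proj (v : live_net) : induced_set S := exist _ (proj (val v)) (valP v).
Definition live_input (v : G) : cg_input :=
  ((id v, nbrs id (fun u => proj u \in S) v), (id (center (proj v)), id (par v))).

Definition run_conf (t : nat) (a : live_net -> state A) (mk : G -> seq nat) :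
    G -> state spanner_protocol := fun v =>
  if insub v is Some v' then Run t (live_input v) (a v') (mk v) else Dead (mk v).

Lemma run_confS t a mk (v : live_net) :
  run_conf t a mk (val v) = Run t (live_input (val v)) (a v) (mk (val v)).
Proof. by rewrite /run_conf valK. Qed.

Lemma run_confN t a mk v : proj v \notin S -> run_conf t a mk v = Dead (mk v).
Proof. by move=> vS; rewrite /run_conf insubN. Qed.

Lemma live_id_inj : injective live_id.
Proof. by move=> u v /id_inj/val_inj. Qed.

Lemma liveP v : proj v \in S -> exists v' : live_net, val v' = v.
Proof. by move=> vS; exists (exist _ v vS). Qed.

Lemma compute_run t a mk : t < T ->
  compute_all (run_conf t a mk) = bind (compute_all a) (fun a' => Ret (run_conf t a' mk)).
Proof.
move=> tT; rewrite /compute_all enum_induced.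
elim: (enum G) a => //= v l IH a.
have [v' _ <-|vS] := insubP; last first.
  rewrite run_confN //= -IH; congr (foldr _ _ _ _).
  by apply: funext => w; rewrite /upd; case: eqP => // ->; rewrite run_confN.
rewrite run_confS /= tT !bindA; congr bind; apply: funext => s /=.
rewrite -IH; congr (foldr _ _ _ _).
apply: funext => w; rewrite /upd; case: eqP => [->|wv]; first by rewrite run_confS eqxx.
rewrite /run_conf; have [w' _ Ew|//] := insubP.
by case: eqP => // E; case: wv; rewrite -Ew E.
Qed.

(** A dead node sends the empty string, which is also what an inbox holds at an identifier that
    belongs to no neighbour. Hence the inboxes in [G] and in the live network coincide. *)
Lemma round_run t a mk : t < T ->
  round id (run_conf t a mk) =
  bind (round live_id a) (fun a' => Ret (run_conf t.+1 a' mk)).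
Proof.
move=> tT; rewrite /round compute_run // !bindA; congr bind; apply: funext => {}a /=.
congr Ret; apply: funext => v.
have [vS|vS] := boolP (proj v \in S); last by rewrite !run_confN.
have [v' <-] := liveP vS; rewrite !run_confS /= tT; congr (Run _ _ (recv _ _) _).
apply: funext => k; rewrite /inbox; case: pickP => [u /andP[vu /eqP <-]|nu].
  have [uS|uS] := boolP (proj u \in S); last first.
    rewrite run_confN //=; case: pickP => // w /andP[_ /eqP/id_inj E].
    by rewrite -E (valP w) in uS.
  have [u' Eu] := liveP uS; rewrite -Eu run_confS /= tT.
  case: pickP => [w /andP[_ /eqP/live_id_inj-> //]|/(_ u')].
  have -> : induced_adj v' u' by rewrite /induced_adj Eu.
  by rewrite -[live_id u']/(id (sval u')) eqxx.
by case: pickP => // w /andP[vw wk]; have := nu (val w); rewrite [adj _ _]vw [_ == k]wk.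
Qed.

Lemma rounds_run t k a mk : t + k <= T ->
  rounds id k (run_conf t a mk) =
  bind (rounds live_id k a) (fun a' => Ret (run_conf (t + k) a' mk)).
Proof.
elim: k t a => [|k IH] t a tk; first by rewrite addn0.
have tT : t < T by apply: leq_trans tk; rewrite addnS ltnS leq_addr.
rewrite /= round_run //.
rewrite !bindA; congr bind; apply: funext => {}a /=.
by rewrite IH addSnnS // -addSnnS.
Qed.

End Live.

(** * Election of the joining node of a fibre *)

Section Joining.
Variables (S : {set Q}) (X : clustering (induced_set S)).
Let cX := clustered X.
Let S' := S :\: cX.

Definition clu (v : G) : bool := proj v \in cX.
Definition cl (v : G) : seq nat := nbrs id clu v.

Definition join_conf (t : nat) (via : G -> option nat) (tok : G -> bool)
    (mk : G -> seq nat) : G -> state spanner_protocol := fun v =>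
  if proj v \in S then Join t (live_input S' v) (clu v) (cl v) (via v) (tok v) (mk v)
  else Dead (mk v).

Definition got (msg : G -> G -> bool) (v : G) : seq nat :=
  nbrs id (fun u => (proj u \in S') && msg u v) v.

Lemma mem_got msg v k :
  (k \in got msg v) <-> exists u, [/\ adj v u, proj u \in S', msg u v & id u = k].
Proof.
rewrite mem_nbrs; split=> [[u [vu /andP[uS uv] E]]|[u [vu uS uv E]]]; exists u; split=> //.
by rewrite uS.
Qed.

Definition via0 (v : G) : option nat :=
  if (proj v \in S') && (cl v != [::]) then Some (id v) else None.
Definition tok0 (v : G) : bool := id v == id (center (proj v)).

(** [up], [down] and [sel] restate the [Join] rounds as maps on functions over [G], so that the
    election can be studied without messages. *)
Definition up (via : G -> option nat) (v : G) : option nat :=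
  if via v is Some k then Some k
  else ohead (got (fun u v => isSome (via u) && (id v == id (par u))) v).

Definition down (via : G -> option nat) (tok : G -> bool) (v : G) : bool :=
  tok v || (got (fun u v => tok u && (via u == Some (id v))) v != [::]).

Definition sel (via : G -> option nat) (tok : G -> bool) (v : G) : bool :=
  tok v && (via v == Some (id v)).

Definition join_marks (via : G -> option nat) (tok : G -> bool) (v : G) : seq nat :=
  if proj v \in S then
    (if sel via tok v then take 1 (cl v) else [::]) ++
    got (fun u v => sel via tok u && (ohead (cl u) == Some (id v))) v
  else [::].

Lemma sub_live x : x \in S' -> x \in S.
Proof. by rewrite inE => /andP[]. Qed.

Lemma next_filter (st : G -> state spanner_protocol) (msg : G -> G -> bool) v :
  (forall u, proj u \in S' -> node_send (st u) (id v) = nseq (msg u v) true) ->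
  [seq k <- nbrs id (fun u => proj u \in S') v | inbox id st v k != [::]] = got msg v.
Proof.
move=> msgE; rewrite nbrs_filter; apply: eq_nbrs => u vu.
have [uS|//] := boolP (proj u \in S'); rewrite inboxE // /= msgE //.
by case: (msg u v).
Qed.

Lemma round_up t via tok mk : t < r ->
  round id (join_conf t via tok mk) = Ret (join_conf t.+1 (up via) tok mk).
Proof.
move=> tr; rewrite round_det; last by move=> v; rewrite /join_conf; case: ifP.
congr Ret; apply: funext => v; rewrite {1 3}/join_conf; case: ifP => vS //=.
rewrite tr (next_filter (msg := fun u v => isSome (via u) && (id v == id (par u)))) //.
by move=> u /sub_live uS; rewrite /join_conf uS /= tr.
Qed.

Lemma round_down t via tok mk : r <= t < r + r ->
  round id (join_conf t via tok mk) = Ret (join_conf t.+1 via (down via tok) mk).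
Proof.
case/andP=> rt tr; rewrite round_det; last by move=> v; rewrite /join_conf; case: ifP.
congr Ret; apply: funext => v; rewrite {1 3}/join_conf; case: ifP => vS //=.
rewrite ltnNge rt /= tr (next_filter (msg := fun u v => tok u && (via u == Some (id v)))) //.
by move=> u /sub_live uS; rewrite /join_conf uS /= ltnNge rt tr.
Qed.

Definition via (t : nat) : G -> option nat := iter t up via0.
Definition tok (t : nat) : G -> bool := iter t (down (via r)) tok0.

Lemma via_stable t t' v k : via t v = Some k -> via (t' + t) v = Some k.
Proof. by move=> E; elim: t' => //= t' IH; rewrite /up -/(via _) IH. Qed.

Lemma tok_mono t t' v : tok t v -> tok (t' + t) v.
Proof. by move=> E; elim: t' => //= t' IH; rewrite /down -/(tok _) IH. Qed.

(** The strict inequality [t' < t] is the point: following [via] pointers goes back in time, which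
    is the induction measure of [tok_reach]. *)
Lemma via_sound t v k : via t v = Some k ->
  (k = id v /\ proj v \in S' /\ cl v != [::]) \/
  exists u, [/\ adj v u, id u = k, par u = v, proj u \in S'
    & exists2 t', t' < t & isSome (via t' u)].
Proof.
elim: t k => [|t IH] k /=.
  by rewrite /via0; case: ifP => // /andP[vS cv] [<-]; left.
rewrite /up -/(via t); case E: (via t v) => [l|].
  move=> [<-]; case: (IH _ E) => [|[u [vu uk pu uS [t' tt' ut']]]]; first by left.
  by right; exists u; split=> //; exists t' => //; apply: leqW.
case/ohead_nbrs=> u [vu /and3P[uS ut /eqP/id_inj pu] uk]; right; exists u; split=> //.
by exists t.
Qed.

Lemma via_up t v : proj v \in S' -> isSome (via t v) -> isSome (via t.+1 (par v)).
Proof.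
move=> vS tv; rewrite /= /up -/(via t); case E: (via t (par v)) => [//|].
have [pv|pv] := eqVneq (par v) v; first by rewrite pv in E; rewrite E in tv.
have : id v \in got (fun u v => isSome (via t u) && (id v == id (par u))) (par v).
  by apply/mem_got; exists v; rewrite adj_sym par_adj // tv eqxx.
by case: got.
Qed.

Lemma via_iter v k : proj v \in S' -> cl v != [::] -> isSome (via k (iter k par v)).
Proof.
move=> vS cv; elim: k => [|k IH]; first by rewrite /= /via0 vS cv.
rewrite iterS; apply: via_up IH; elim: k => //= k IH; by rewrite par_proj.
Qed.

Lemma via_center v : proj v \in S' -> cl v != [::] -> isSome (via r (center (proj v))).
Proof.
move=> vS cv; have [k kr E] := par_radius v.
have := via_iter k vS cv; rewrite E; case Ev: via => [l|//] _.
by rewrite -(subnK kr) (via_stable _ Ev).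
Qed.

(** Each step of the token moves to a node whose [via] was set strictly earlier than that of the
    current node. So after at most [t] steps it is at a node that set its own identifier, that is,
    at a candidate. *)
Lemma tok_reach t s w : t <= r -> proj w \in S' -> tok s w -> isSome (via t w) ->
  exists2 z, proj z = proj w & tok (s + t) z /\ via r z = Some (id z).
Proof.
elim/ltn_ind: t s w => t IH s w tr wS ws; case Ew: (via t w) => [k|//] _.
have Ewr : via r w = Some k by rewrite -(subnK tr) (via_stable _ Ew).
case: (via_sound Ew) => [[Ek _]|[u [wu uk pu uS [t' tt' ut']]]].
  by exists w; rewrite // addnC tok_mono // Ewr Ek.
have us : tok s.+1 u.
  rewrite /= /down -/(tok s); apply/orP; right.
  have : id w \in got (fun u v => tok s u && (via r u == Some (id v))) u.
    by apply/mem_got; exists w; rewrite adj_sym wu ws Ewr uk eqxx.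
  by case: got.
have [|z zu [zt zz]] := IH t' tt' s.+1 u _ uS us ut'.
  by apply: leq_trans tr; apply: ltnW.
exists z; first by rewrite zu -pu par_proj.
split=> //; move: zt; rewrite addSnnS => zt.
have := tok_mono (t - t'.+1) zt; rewrite addnA [_ - _ + _]addnC -addnA subnK //.
Qed.

Lemma sel_exists v : proj v \in S' -> cl v != [::] ->
  exists2 z, proj z = proj v & sel (via r) (tok r) z.
Proof.
move=> vS cv; have pc : proj (center (proj v)) = proj v by apply: cg_centerK.
have [|||z zv [zt zz]] := @tok_reach r 0 (center (proj v)) (leqnn r).
- by rewrite pc.
- by rewrite /= /tok0 pc eqxx.
- exact: via_center.
- by exists z; [rewrite zv pc | rewrite /sel -zz eqxx andbT].
Qed.

Definition nxt (v : G) : G := odflt v [pick w | via r v == Some (id w)].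

Lemma nxtE v w : via r v = Some (id w) -> nxt v = w.
Proof.
move=> E; rewrite /nxt; case: pickP => [u|/(_ w)]; last by rewrite E eqxx.
by rewrite E => /eqP[/id_inj].
Qed.

(* The token only ever visits the [via]-chain starting at the centre. *)
Lemma tok_chain t w : tok t w -> exists j, w = iter j nxt (center (proj w)).
Proof.
elim: t w => [|t IH] w /=.
  by rewrite /tok0 => /eqP/id_inj E; exists 0.
rewrite /down -/(tok t); case/orP => [/IH //|].
case E: got => [//|k l] _.
have /mem_got[u [wu uS /andP[ut /eqP uw] uk]] :
    k \in got (fun u v => tok t u && (via r u == Some (id v))) w by rewrite E mem_head.
have pu : proj u = proj w.
  case: (via_sound uw) => [[/id_inj Ewu]|[w' [_ /id_inj-> <- _ _]]]; last exact: par_proj.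
  by rewrite Ewu adj_irr in wu.
have [j Ej] := IH _ ut; exists j.+1.
by rewrite iterS -pu -Ej; apply/esym/nxtE.
Qed.

(** Both nodes lie on the orbit of [nxt] from their common centre and both are fixed points of
    [nxt]; the orbit cannot leave the first fixed point that it meets. *)
Lemma sel_inj z z' : sel (via r) (tok r) z -> sel (via r) (tok r) z' ->
  proj z = proj z' -> z = z'.
Proof.
move=> /andP[/tok_chain[j Ej] /eqP/nxtE zz] /andP[/tok_chain[j' Ej'] /eqP/nxtE zz'] pz.
have fix_iter y i : nxt y = y -> iter i nxt y = y by move=> yy; elim: i => //= i ->.
rewrite -pz in Ej'.
have [jj'|/ltnW jj'] := leqP j j'.
  by rewrite Ej' -(subnK jj') iterD -Ej fix_iter.
by rewrite Ej -(subnK jj') iterD -Ej' fix_iter.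
Qed.

(** A node finds its own identifier in [via] only if it was put there at the start: otherwise it
    would be its own neighbour. *)
Lemma sel_cand z : sel (via r) (tok r) z -> proj z \in S' /\ cl z != [::].
Proof.
case/andP=> _ /eqP/via_sound[[_ //]|[u [zu /id_inj E]]].
by rewrite E adj_irr in zu.
Qed.

(** Since [cl z] is sorted, this is the clustered neighbour of smallest identifier. *)
Definition nearest (z : G) : G := odflt z [pick u | ohead (cl z) == Some (id u)].

Lemma nearestP z : cl z != [::] ->
  [/\ adj z (nearest z), clu (nearest z) & ohead (cl z) = Some (id (nearest z))].
Proof.
move=> cz; have [k Ek] : exists k, ohead (cl z) = Some k by case: cl cz => // k; exists k.
have [u [zu uX uk]] := ohead_nbrs Ek; rewrite -uk in Ek.
suff -> : nearest z = u by [].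
rewrite /nearest; case: pickP => [w|/(_ u)]; last by rewrite Ek eqxx.
by rewrite Ek => /eqP[/id_inj].
Qed.

Definition fibre_joins : {set {set Q}} :=
  [set [set proj z; proj (nearest z)] | z in sel (via r) (tok r)].

(** Uniqueness of the elected node ([sel_inj]) gives at most one edge per vertex of [Q], and
    existence ([sel_exists]) gives the joining property. The elected node need not be the endpoint
    [u] that witnesses the adjacency, so the edge may lead to another clustered vertex of [Q]. *)
Lemma fibre_joinsP : joins X fibre_joins.
Proof.
have adjQ u v : adj u v -> proj u \in S' -> clu v -> adj (proj u) (proj v).
  move=> uv uS vX; rewrite cg_adj; apply/andP; split.
    by apply: contraTneq uS => ->; rewrite inE [_ \in cX]vX.
  by apply/existsP; exists u; apply/existsP; exists v; rewrite uv !eqxx.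
split.
- apply/subsetP => _ /imsetP[z /sel_cand[zS cz] ->]; rewrite mem_edges.
  by have [zn nX _] := nearestP cz; apply: adjQ.
- apply: leq_trans (leq_imset_card _ _) _.
  rewrite -(card_in_imset (f := proj)); last by move=> z z'; apply: sel_inj.
  apply: subset_leq_card; apply/subsetP => _ /imsetP[z /sel_cand[zS _] ->].
  exact: sub_live.
- move=> x y xS yX; rewrite cg_adj => /andP[_ /existsP[u /existsP[v]]].
  case/and3P=> uv /eqP ux /eqP vy.
  have uS : proj u \in S' by rewrite /proj ux.
  have cu : cl u != [::].
    have : id v \in cl u by apply/mem_nbrs; exists v; rewrite uv /clu /proj vy.
    by case: cl.
  have [z zu zsel] := sel_exists uS cu.
  have [zS cz] := sel_cand zsel; have [zn nX _] := nearestP cz.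
  have zx : proj z = x by rewrite zu.
  exists (proj (nearest z)); split=> //; first by rewrite -zx adjQ.
  by apply/imsetP; exists z; rewrite ?zx.
Qed.

Lemma join_marksP : encodes_edges id proj (join_marks (via r) (tok r)) fibre_joins.
Proof.
have sent z k : (k \in (if sel (via r) (tok r) z then take 1 (cl z) else [::])) <->
    sel (via r) (tok r) z /\ k = id (nearest z).
  case: ifP => zsel; last by split=> // -[].
  have [_ cz] := sel_cand zsel; have [_ _] := nearestP cz.
  case: cl => // a l [->] /=; rewrite take0 inE.
  by split=> [/eqP|[_ ->]].
have nsel z : sel (via r) (tok r) z -> proj z \in S /\ proj (nearest z) \in S.
  move=> zsel; have [zS cz] := sel_cand zsel; have [_ nX _] := nearestP cz.
  by split; [exact: sub_live | exact: (subsetP (clustered_sub X))].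
(* A mark at [u] arises in two ways: [u] was elected and chose [v], or [v] was elected and notified
   [u]. The symmetry of this description makes the marks known to both endpoints. *)
have markE u v : adj u v -> (id v \in join_marks (via r) (tok r) u) <->
    (sel (via r) (tok r) u /\ v = nearest u) \/ (sel (via r) (tok r) v /\ u = nearest v).
  move=> uv; rewrite /join_marks; split.
    case: ifP => // uS; rewrite mem_cat => /orP[/sent[us /id_inj]|]; first by left.
    case/mem_got=> w [uw wS /andP[ws /eqP wu] /id_inj wv]; right; rewrite -wv; split=> //.
    by have [_ cw] := sel_cand ws; have [_ _] := nearestP cw; rewrite wu => -[/id_inj].
  case=> [[us vn]|[vs un]].
    have [-> _] := nsel _ us; rewrite mem_cat; apply/orP; left.
    by apply/sent; rewrite vn.
  have [_] := nsel _ vs; rewrite -un => ->; rewrite mem_cat; apply/orP; right.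
  have [vS cv] := sel_cand vs; have [_ _ E] := nearestP cv.
  by apply/mem_got; exists v; rewrite vs E -un eqxx.
have adj_mark u k : k \in join_marks (via r) (tok r) u -> exists2 v, adj u v & id v = k.
  rewrite /join_marks; case: ifP => // uS; rewrite mem_cat => /orP[/sent[us ->]|].
    have [_ cu] := sel_cand us; have [un _ _] := nearestP cu.
    by exists (nearest u).
  by case/mem_got=> v [uv _ _ <-]; exists v.
split=> [u k uk|x y].
  have [v uv vk] := adj_mark _ _ uk; exists v; split=> //.
  rewrite -vk in uk; apply/(markE v u); first by rewrite adj_sym.
  by case/(markE u v uv): uk; [right | left].
split.
  case/imsetP=> z zsel /set2_inj E.
  have [_ cz] := sel_cand zsel; have [zn _ _] := nearestP cz.
  case: E => [[-> ->]|[-> ->]].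
    by exists z, (nearest z); split=> //; apply/markE => //; left.
  by exists (nearest z), z; split=> //; apply/markE; [rewrite adj_sym | right].
case=> u [v [<- <- vu]]; have [w uw /id_inj Ew] := adj_mark _ _ vu.
rewrite Ew in uw; case/(markE u v uw): vu => [[us ->]|[vs ->]].
  by apply/imsetP; exists u.
by rewrite setUC; apply/imsetP; exists v.
Qed.

Definition next_start (v : live_net S') : state A := init A (live_input S' (val v)).

(** The result has again the shape [run_conf 0], now for the smaller set, so the phases can be
    iterated by induction. *)
Lemma round_notify via tok mk :
  round id (join_conf (r + r) via tok mk) =
  Ret (run_conf 0 next_start (fun v => mk v ++ join_marks via tok v)).
Proof.
rewrite round_det; last by move=> v; rewrite /join_conf; case: ifP.
congr Ret; apply: funext => v; rewrite {1}/join_conf; case: ifPn => vS /=; last first.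
  have vS' : proj v \notin S' by apply: contra vS; apply: sub_live.
  by rewrite run_confN // /join_marks (negbTE vS) cats0.
rewrite ltnNge leq_addr ltnn /=.
rewrite (next_filter
  (msg := fun u v => sel via tok u && (ohead (cl u) == Some (id v)))); last first.
  by move=> u /sub_live uS; rewrite /join_conf uS /= ltnNge leq_addr ltnn.
case: ifPn => vX.
  have vS' : proj v \notin S' by rewrite inE negb_and negbK [_ \in cX]vX.
  by rewrite run_confN // /join_marks vS.
have vS' : proj v \in S' by rewrite inE vS andbT.
by have [v' Ev] := liveP vS'; rewrite -Ev run_confS /next_start /join_marks Ev vS.
Qed.

Variable a : live_net S -> state A.
Hypothesis a_clu : forall v : live_net S, isSome (output (a v)).1 = clu (val v).

Definition out_marks (v : G) : seq nat :=
  if insub v is Some v' then [seq b.2 | b <- (output (a v')).2] else [::].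

Lemma round_announce mk :
  round id (run_conf T a mk) = Ret (join_conf 0 via0 tok0 (fun v => mk v ++ out_marks v)).
Proof.
rewrite round_det; last first.
  by move=> v; rewrite /run_conf; case: insubP => //= *; rewrite ltnn.
have msgE u v : node_send (run_conf T a mk u) (id v) = nseq (clu u) true.
  have [uS|uS] := boolP (proj u \in S).
    by have [u' <-] := liveP uS; rewrite run_confS /= ltnn a_clu.
  have /negbTE uX : ~~ clu u by apply: contra uS; apply: (subsetP (clustered_sub X)).
  by rewrite run_confN //= uX.
congr Ret; apply: funext => v; rewrite /join_conf /out_marks.
case: ifPn => vS; last by rewrite run_confN //= insubN // cats0.
have [v' Ev] := liveP vS; rewrite -Ev run_confS valK /= ltnn a_clu Ev [sval v']Ev.
have E1 : [seq k <- nbrs id (fun u => proj u \in S) v |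
    inbox id (run_conf T a mk) v k != [::]] = cl v.
  rewrite nbrs_filter; apply: eq_nbrs => u vu; rewrite inboxE // /= msgE.
  have [uX|uX] := boolP (clu u); last by rewrite andbF.
  by rewrite (subsetP (clustered_sub X)).
have E2 : [seq k <- nbrs id (fun u => proj u \in S) v |
    inbox id (run_conf T a mk) v k == [::]] = nbrs id (fun u => proj u \in S') v.
  rewrite nbrs_filter; apply: eq_nbrs => u vu; rewrite inboxE // /= msgE inE.
  by rewrite -[_ \in cX]/(clu u) andbC; case: (clu u).
by rewrite E1 E2 /via0 /live_input inE vS andbT.
Qed.

Lemma rounds_up t mk : t <= r ->
  rounds id t (join_conf 0 (via 0) tok0 mk) = Ret (join_conf t (via t) tok0 mk).
Proof.
elim: t => // t IH tr; rewrite -addn1 (rounds_ret _ (IH (ltnW tr))) rounds1 round_up //.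
by rewrite addn1.
Qed.

Lemma rounds_down t mk : t <= r ->
  rounds id t (join_conf r (via r) (tok 0) mk) = Ret (join_conf (r + t) (via r) (tok t) mk).
Proof.
elim: t => [|t IH] tr; first by rewrite addn0.
rewrite -addn1 (rounds_ret _ (IH (ltnW tr))) rounds1 round_down ?leq_addr ?ltn_add2l //.
by rewrite addn1 addnS.
Qed.

Lemma rounds_join mk :
  rounds id (1 + (r + (r + 1))) (run_conf T a mk) =
  Ret (run_conf 0 next_start
    (fun v => (mk v ++ out_marks v) ++ join_marks (via r) (tok r) v)).
Proof.
rewrite (@rounds_ret _ _ _ _ _ 1 _ _ _ (etrans (rounds1 _ _) (round_announce mk))).
rewrite (rounds_ret _ (rounds_up _ (leqnn r))) (rounds_ret _ (rounds_down _ (leqnn r))).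
by rewrite rounds1 round_notify.
Qed.

End Joining.

(** * From the output of [A] to marked edges *)

Section Encoding.
Variables (S : {set Q}) (X : clustering (induced_set S)) (a : live_net S -> state A).
Hypothesis enc :
  encodes_clustering (@live_id S) (@live_proj S) (fun v => output (a v)) X.
Hypothesis trees : {in clusters X, forall C, is_tree (tverts X C) (tedges X C)}.

Lemma output_clu (v : live_net S) : isSome (output (a v)).1 = clu X (val v).
Proof.
have [lab [_ cE _ _]] := enc; apply/idP/idP.
  case E: (output (a v)).1 => [l|//] _; have [C [CX vC _]] := (cE v l).1 E.
  apply/imsetP; exists (live_proj v) => //; apply/bigcupP; by exists C.
case/clusteredP=> C [x [CX xC vx]].
have vC : live_proj v \in C by rewrite (_ : live_proj v = x) //; apply: val_inj.
by rewrite ((cE v (lab C)).2 _) //; exists C.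
Qed.

Lemma out_marksP : encodes_edges id proj (out_marks a) (forest_edges X).
Proof.
have [lab [_ _ tE tagE]] := enc.
have markP u k : k \in out_marks a u <-> exists (u' : live_net S) C,
    [/\ val u' = u, C \in clusters X &
     k \in [seq b.2 | b <- (output (a u')).2 & b.1 == lab C]].
  split.
    rewrite /out_marks; case: insubP => //= u' _ uu' /mapP[b bu ->].
    have [C CX Cb] := tagE _ _ bu; exists u', C; split=> //.
    by apply: map_f; rewrite mem_filter Cb eqxx.
  case=> u' [C [<- CX /mapP[b]]]; rewrite mem_filter => /andP[_ bu] ->.
  by rewrite /out_marks valK; apply: map_f.
split=> [u k /markP[u' [C [uu' CX]]]|x y].
  case/(tE _ CX).1 => v' [uv vk vu]; exists (val v'); split=> //.
    by rewrite -uu'.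
  by apply/markP; exists v', C; split=> //; rewrite -uu'.
split.
  case/bigcupP=> C CX /imsetP[f fC Ef].
  have [FE _ _ _ _] := trees CX.
  have [x' [y' [xx' yy' xyC]]] : exists x' y' : induced_set S,
      [/\ val x' = x, val y' = y & [set x'; y'] \in tedges X C].
    have [c [d [_ Ecd]]] := edgesP (subsetP FE _ fC).
    move: Ef; rewrite Ecd lift_set2; rewrite Ecd in fC.
    case/set2_inj=> -[-> ->]; first by exists c, d.
    by exists d, c; split=> //; rewrite setUC.
  have [u' [v' [ux vy uv]]] := ((tE _ CX).2 x' y').1 xyC.
  exists (val u'), (val v'); split; first by rewrite -xx' -ux.
    by rewrite -yy' -vy.
  by apply/markP; exists u', C.
case=> u [v [<- <- /markP[u' [C [uu' CX uv]]]]].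
have [v' [_ /id_inj vv' _]] := (tE _ CX).1 u' _ uv.
apply/bigcupP; exists C => //; apply/imsetP; exists [set live_proj u'; live_proj v'].
  by apply/(tE _ CX).2; exists u', v'; rewrite [live_id v'](f_equal id vv').
by rewrite lift_set2 -uu' -vv'.
Qed.

End Encoding.

Definition start (S : {set Q}) (v : live_net S) : state A := init A (live_input S (val v)).

(** Absorbs the rounds by which the promised running time exceeds that of the phases. *)
Lemma rounds_dead e a mk : rounds id e (@run_conf set0 0 a mk) = Ret (@run_conf set0 0 a mk).
Proof.
have dead v : @run_conf set0 0 a mk v = Dead (mk v) by rewrite run_confN // inE.
elim: e => //= e IH; rewrite round_det /=; last by move=> v; rewrite dead.
set st := (X in rounds _ _ X); suff -> : st = run_conf 0 a mk by [].
by apply: funext => v; rewrite /st dead.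
Qed.

Context (R : realType) (D : nat) (xi delta : R).
Hypothesis delta_ge0 : (0 <= delta)%R.
(** The guarantee of [A] on every live network, for the input that the simulated nodes hold. For
    cluster graphs it comes from [sub_cluster_graph]; for plain CONGEST only the first component of
    the input is used, and it equals the [node_input] of the live network. *)
Hypothesis AP : forall S : {set Q},
  (1 - delta <= pr R (congest_output A (@live_id S) (fun v => live_input S (val v)) T)
     (fun out => exists X : clustering (induced_set S),
        weak_diam_clustering 3 D xi X /\
        encodes_clustering (@live_id S) (@live_proj S) out X))%R.

Definition phase_length : nat := T + (1 + (r + (r + 1))).

Lemma phasesP k e (S : {set Q}) H mk :
  #|S| < 2 ^ k -> spanner_inv D xi S H -> encodes_edges id proj mk H ->
  (1 - k%:R * delta <=
   pr R (rounds id (k * phase_length + e) (run_conf 0 (@start S) mk))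
     (fun st => exists2 H : {set {set Q}}, spanner_inv D xi set0 H &
        encodes_edges id proj (fun v => node_output (st v)) H))%R.
Proof.
elim: k S H mk => [|k IH] S H mk Sk inv encH.
  have S0 : S = set0 by apply/eqP; rewrite -cards_eq0 -leqn0 -ltnS -(expn0 2).
  rewrite {}S0 in inv *; rewrite rounds_dead /= asboolT ?mul0r ?subr0 //; exists H => //.
  suff -> : (fun v => node_output (run_conf 0 (@start set0) mk v)) = mk by [].
  by apply: funext => v; rewrite run_confN // inE.
rewrite mulSn -addnA -nat1r mulrDl mul1r {1}/phase_length -addnA rounds_add.
rewrite rounds_run // add0n bindA.
(* All coins of the phase are tossed while [A] runs. Given a good outcome, the remaining rounds of
   the phase are deterministic. *)
apply: (@pr_bind _ _ _ _ _ (fun a => exists X : clustering (induced_set S),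
        weak_diam_clustering 3 D xi X /\
        encodes_clustering (@live_id S) (@live_proj S) (fun v => output (a v)) X)).
- by rewrite mulr_ge0.
- by have := AP S; rewrite /congest_output pr_bind_ret.
- move=> a [X [XP Xenc]]; rewrite bind_ret.
  have trees : {in clusters X, forall C, is_tree (tverts X C) (tedges X C)}.
    by case: XP => _ tX _ _ _ C /tX[].
  rewrite (rounds_ret _ (rounds_join (output_clu Xenc) mk)).
  apply: (IH _ (H :|: forest_edges X :|: fibre_joins X)).
  + by apply: card_unclustered Sk; case: XP.
  + by apply: phase_spanner_inv XP _ => //; apply: fibre_joinsP.
  + apply: encodes_edgesU; last exact: join_marksP.
    by apply: encodes_edgesU => //; apply: out_marksP.
Qed.

Lemma spanner_protocolP k e : #|Q| < 2 ^ k ->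
  (1 - k%:R * delta <=
   pr R (congest_output spanner_protocol id (cg_node_input Q id) (k * phase_length + e))
     (fun out => exists2 H : {set {set Q}}, spanner_inv D xi set0 H &
        encodes_edges id proj out H))%R.
Proof.
move=> Qk; rewrite /congest_output pr_bind_ret.
have -> : (fun v => init spanner_protocol (cg_node_input Q id v)) =
    run_conf 0 (@start setT) (fun=> [::]).
  apply: funext => v.
  have inpE : normalize (cg_node_input Q id v) = live_input setT v.
    rewrite /normalize /live_input /= (inj_eq id_inj) /node_input -nbrsT /par.
    congr (_, _, (_, _)); first by apply: eq_nbrs => u _; rewrite inE.
    by case: eqP.
  have [v' Ev] := liveP (in_setT (proj v)).
  by rewrite -Ev run_confS /start Ev /= /node_init inpE.
apply: (phasesP _ _ (spanner_inv0 _ _ _)); first by rewrite cardsT.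
by split=> // x y; rewrite inE; split=> // -[u [v []]].
Qed.

End Run.
End SpannerProtocol.

(** * Cluster graphs on which [A] is rerun *)

Section SubClusterGraph.
Context (r : nat) (G : sgraph) (Q : cluster_graph r G) (S : {set Q}).

Definition sub_center (x : induced_set S) : live_net S :=
  exist _ (cg_center (val x))
    (etrans (f_equal (fun y => y \in S) (cg_centerK (val x))) (valP x)).

Definition sub_parent (v : live_net S) : live_net S :=
  exist _ (par Q (val v))
    (etrans (f_equal (fun y => y \in S) (par_proj Q (val v))) (valP v)).

Lemma sub_adj (x y : induced_set S) : adj x y = (x != y) &&
  [exists u, exists v, [&& adj u v, @live_proj r G Q S u == x & live_proj v == y]].
Proof.
rewrite /= /induced_adj cg_adj -(inj_eq val_inj); congr andb.
apply/existsP/existsP => -[u /existsP[v /and3P[uv /eqP ux /eqP vy]]].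
  have uS : cg_proj Q u \in S by rewrite ux (valP x).
  have vS : cg_proj Q v \in S by rewrite vy (valP y).
  exists (exist _ u uS); apply/existsP; exists (exist _ v vS).
  by apply/and3P; split=> //; apply/eqP/val_inj.
exists (val u); apply/existsP; exists (val v).
by rewrite -ux -vy !eqxx !andbT.
Qed.

Lemma sub_centerK : cancel sub_center (@live_proj r G Q S).
Proof. by move=> x; apply: val_inj; rewrite /= cg_centerK. Qed.

Lemma sub_parentP (v : live_net S) : v != sub_center (live_proj v) ->
  adj v (sub_parent v) /\ live_proj (sub_parent v) = live_proj v.
Proof.
rewrite -(inj_eq val_inj) /= => vc; split; last first.
  by apply: val_inj; rewrite /= par_proj.
by rewrite /induced_adj /= /par (negbTE vc); have [] := cg_parentP vc.
Qed.

Lemma sub_radius (v : live_net S) : exists2 k, k <= r &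
  iter k sub_parent v = sub_center (live_proj v).
Proof.
have [k kr E] := par_radius Q (val v); exists k => //; apply: val_inj.
rewrite /= -E; elim: k {kr E} => //= k ->; by [].
Qed.

(** Fibres are deleted as a whole, so a surviving fibre keeps its centre and all its tree paths, and
    the radius bound is still [r]. *)
Definition sub_cluster_graph : cluster_graph r (live_net S) :=
  ClusterGraph sub_adj sub_centerK sub_parentP sub_radius.

End SubClusterGraph.

Section TrivialClusterGraph.
Context (r : nat) (G : sgraph).

Lemma trivial_adj (x y : G) : adj x y = (x != y) &&
  [exists u, exists v, [&& adj u v, u == x & v == y]].
Proof.
apply/idP/andP => [xy|[_ /existsP[u /existsP[v /and3P[uv /eqP<- /eqP<-]]]] //].
split; first by apply: contraTneq xy => ->; rewrite adj_irr.
by apply/existsP; exists x; apply/existsP; exists y; rewrite xy !eqxx.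
Qed.

Lemma trivial_parentP (v : G) : v != v -> adj v v /\ v = v.
Proof. by rewrite eqxx. Qed.

Lemma trivial_radius (v : G) : exists2 k, k <= r & iter k idfun v = v.
Proof. by exists 0. Qed.

(** Used twice: with [r = 0] it reduces plain CONGEST to cluster graphs, and for any [r] it presents
    the triangle as a valid input. *)
Definition trivial_cluster_graph : cluster_graph r G :=
  @ClusterGraph r G G idfun idfun idfun trivial_adj (fun=> erefl) trivial_parentP trivial_radius.

End TrivialClusterGraph.

(** A phase takes [T + 2 * r + 2] rounds, at most [3 * (T + r)] as [0 < T]; together with
    [lg n + 1 <= 2 * lg n] this is the factor 6. *)
Lemma phase_budget (K n T r : nat) : 6 <= K -> 1 < n -> 0 < T ->
  exists e, K * (lg n * (T + r)) = (lg n).+1 * phase_length T r + e.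
Proof.
move=> K6 n1 T0; exists (K * (lg n * (T + r)) - (lg n).+1 * phase_length T r).
rewrite subnKC // /phase_length.
apply: leq_trans (leq_mul (lgS_leq n1) (leqnn _)) _.
have -> : K * (lg n * (T + r)) = lg n * (K * (T + r)) by rewrite mulnCA.
rewrite mulnAC mulnC leq_mul2l; apply/orP; right.
by apply: leq_trans (leq_mul K6 (leqnn _)); lia.
Qed.

Lemma card_lg n k : 0 < n -> k <= n -> k < 2 ^ (lg n).+1.
Proof. by move=> n0 kn; rewrite (leq_ltn_trans kn) // trunc_log_ltn. Qed.

Lemma valid_ids_sub (G : sgraph) (P : pred G) n c (id : G -> nat) :
  valid_ids n c id -> valid_ids n c (fun v : induced P => id (val v)).
Proof. by move=> [id_inj idn]; split=> [u v /id_inj/val_inj|v]. Qed.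

Lemma card_induced (G : sgraph) (P : pred G) : #|induced P| <= #|G|.
Proof. by rewrite card_sig max_card. Qed.

Lemma K3_ids n c : 2 < n -> 0 < c -> valid_ids n c (fun v : K3 => val v).
Proof.
move=> n2 c0; split; first exact: val_inj.
move=> v; apply: leq_trans (ltn_ord v) _; rewrite (leq_trans n2) //.
by rewrite -{1}(expn1 n) leq_pexp2l // (ltn_trans _ n2).
Qed.

(** For [c = 0] the triangle has no valid identifiers, so nothing can be learnt about [D]; but then
    every admissible network is so small that stretch is not an issue. *)
Lemma valid_ids0 (G : sgraph) n (id : G -> nat) : valid_ids n 0 id -> #|G| <= 1.
Proof.
case=> id_inj id0; apply/card_le1_eqP => u v _ _; apply: id_inj.
by have := id0 u; have := id0 v; rewrite expn0 !ltnS !leqn0 => /eqP-> /eqP->.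
Qed.

Lemma cg_card (r : nat) (G : sgraph) (Q : cluster_graph r G) : #|Q| <= #|G|.
Proof. exact: leq_card (can_inj (@cg_centerK _ _ Q)). Qed.

(** * The two CONGEST claims *)

Lemma cg_congest_spanner (R : realType) (K n r c T D : nat) (xi delta : R)
    (A : protocol cg_input cl_out) :
  6 <= K -> 2 < n -> 0 < T -> cg_congest_clusters n r c T D xi delta A ->
  cg_congest_spans n r c (K * (lg n * (T + r))) (K * D) (K%:R * xi)%R
    ((K * lg n)%:R * delta)%R (spanner_protocol T r A).
Proof.
move=> K6 n2 T0 AP G Q id Gn idP; have [id_inj _] := idP.
have lg0 : 0 < lg n by rewrite trunc_log_gt0 (ltnW n2).
have [d1|d1] := leP 1%R delta.
  by apply: pr_trivial => //; rewrite muln_gt0 lg0 (leq_trans _ K6).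
have D0 : 0 < D \/ #|Q| <= 1.
  have [c0|c0] := posnP c.
    right; rewrite c0 in idP; exact: leq_trans (cg_card Q) (valid_ids0 idP).
  left; have K3n : #|K3| <= n by rewrite card_ord.
  have /pr_sat[//|out [X [/K3_clustering[]]]] // :=
    AP K3 (trivial_cluster_graph r K3) _ K3n (K3_ids n2 c0).
have d0 := pr_ge_delta (AP G Q id Gn idP).
have [e ->] := phase_budget r K6 (ltnW n2) T0.
apply: (pr_slack d0 _ _ (@spanner_protocolP T r A G Q id id_inj R D xi delta d0 _ _ _ _)).
- by apply: leq_trans (lgS_leq (ltnW n2)) _; rewrite leq_mul2r (leq_trans _ K6) ?orbT.
- by move=> out [H inv enc]; exists H; have [] := spanner_inv_final K6 D0 inv.
- move=> S; have := AP (live_net S) (sub_cluster_graph S) (@live_id r G Q id S).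
  have -> : cg_node_input (sub_cluster_graph S) (@live_id r G Q id S) =
      fun v => live_input id S (val v).
    by apply: funext => v; rewrite /cg_node_input /node_input nbr_ids_induced.
  by apply; [apply: leq_trans Gn; apply: card_induced | apply: valid_ids_sub].
- by apply: card_lg; [exact: leq_trans n2 | exact: leq_trans (cg_card Q) Gn].
Qed.

Definition precompose (In In' Out : Type) (f : In' -> In) (P : protocol In Out) :
    protocol In' Out :=
  Protocol (fun x => init P (f x)) (@compute _ _ P) (@send _ _ P) (@recv _ _ P) (@output _ _ P).

Lemma congest_output_precompose (In In' Out : Type) (f : In' -> In) (P : protocol In Out)
    (G : sgraph) (id : G -> nat) inp t :
  congest_output (precompose f P) id inp t = congest_output P id (fun v => f (inp v)) t.
Proof. by []. Qed.

Definition plain_spanner_protocol (T : nat) (A : protocol input cl_out) :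
    protocol input (seq nat) :=
  precompose (fun inp : input => (inp, (inp.1, inp.1)))
    (spanner_protocol T 0 (precompose fst A)).

Lemma congest_spanner (R : realType) (K n c T D : nat) (xi delta : R)
    (A : protocol input cl_out) :
  6 <= K -> 2 < n -> 0 < T -> congest_clusters n c T D xi delta A ->
  congest_spans n c (K * (lg n * T)) (K * D) (K%:R * xi)%R
    ((K * lg n)%:R * delta)%R (plain_spanner_protocol T A).
Proof.
move=> K6 n2 T0 AP G id Gn idP; have [id_inj _] := idP.
have lg0 : 0 < lg n by rewrite trunc_log_gt0 (ltnW n2).
have [d1|d1] := leP 1%R delta.
  by apply: pr_trivial => //; rewrite muln_gt0 lg0 (leq_trans _ K6).
have D0 : 0 < D \/ #|G| <= 1.
  have [c0|c0] := posnP c; first by right; rewrite c0 in idP; apply: valid_ids0 idP.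
  left; have K3n : #|K3| <= n by rewrite card_ord.
  by have /pr_sat[//|out [X [/K3_clustering[]]]] // := AP K3 _ K3n (K3_ids n2 c0).
have d0 := pr_ge_delta (AP G id Gn idP).
have [e] := phase_budget 0 K6 (ltnW n2) T0; rewrite addn0 => ->.
pose Q := trivial_cluster_graph 0 G.
rewrite /plain_spanner_protocol congest_output_precompose.
apply: (pr_slack d0 _ _ (@spanner_protocolP T 0 (precompose fst A) G Q id id_inj
  R D xi delta d0 _ _ _ _)).
- by apply: leq_trans (lgS_leq (ltnW n2)) _; rewrite leq_mul2r (leq_trans _ K6) ?orbT.
- by move=> out [H inv enc]; exists H; have [] := spanner_inv_final K6 D0 inv.
- move=> S; have := AP (live_net S) (@live_id 0 G Q id S).
  rewrite congest_output_precompose.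
  have -> : (fun v : live_net S => (live_input id S (val v)).1) =
      node_input (@live_id 0 G Q id S).
    by apply: funext => v; rewrite /node_input nbr_ids_induced.
  have -> : @live_proj 0 G Q S = idfun by apply: funext => v; apply: val_inj.
  by apply; [apply: leq_trans Gn; apply: card_induced | apply: valid_ids_sub].
- by apply: card_lg; rewrite // (leq_trans _ n2).
Qed.

(** * PRAM *)

(** A strict upper bound on the indices of the arrays that the code can write. Arrays from there on
    are safe storage while [A] runs; [A] might read them, but its guarantee holds for arbitrary
    contents. *)
Fixpoint written (c : instr) : nat :=
  match c with
  | Par _ _ a _ _ => a.+1
  | Flip _ a => a.+1
  | If _ c1 c2 => maxn (foldr (fun c => maxn (written c)) 0 c1)
                       (foldr (fun c => maxn (written c)) 0 c2)
  | While _ c1 => foldr (fun c => maxn (written c)) 0 c1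
  end.

Definition written_seq (p : program) : nat := foldr (fun c => maxn (written c)) 0 p.

Lemma written_cat p q : written_seq (p ++ q) = maxn (written_seq p) (written_seq q).
Proof. by elim: p => [|c p IH] /=; rewrite ?max0n // -maxnA -IH. Qed.

Definition agree_from (b : nat) (s s' : store) : Prop :=
  forall a, b <= a -> s' a = s a.

Lemma write_par_other s k g a i x b : b != a -> write_par s k g a i x b = s b.
Proof. by move=> ba; apply: funext => j; rewrite /write_par ba. Qed.

Lemma write_parP s k g a i x j (s' := write_par s k g a i x) :
  (exists p, [/\ p < k, eval s p g != 0, eval s p i = j & s' a j = eval s p x]) \/
  (s' a j = s a j /\ forall p, p < k -> eval s p g != 0 -> eval s p i <> j).
Proof.
rewrite /s' /write_par eqxx /=.
case E: [seq _ <- _ | _] => [|p l].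
  right; split=> // p pk gp ip.
  have : p \in [seq p <- iota 0 k | (eval s p g != 0) && (eval s p i == j)].
    by rewrite mem_filter gp ip eqxx mem_iota.
  by rewrite E.
left; exists p; have : p \in p :: l by rewrite mem_head.
by rewrite -E mem_filter mem_iota => /andP[/andP[gp /eqP ip] pk].
Qed.

Lemma write_par_proc s k g a x j :
  write_par s k g a Proc x a j =
  if (j < k) && (eval s j g != 0) then eval s j x else s a j.
Proof.
have [[p [pk gp /= <- ->]]|[-> np]] := write_parP s k g a Proc x j.
  by rewrite pk gp.
by case: ifP => // /andP[jk gj]; case: (np j).
Qed.

Lemma write_par_flag s k g a i j :
  write_par s k g a i (Const 1) a j != 0 <->
  s a j != 0 \/ exists2 p, p < k & eval s p g != 0 /\ eval s p i = j.
Proof.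
have [[p [pk gp ip ->]]|[-> np]] := write_parP s k g a i (Const 1) j.
  by split=> // _; right; exists p.
by split=> [|[//|[p pk [gp ip]]]]; [left | case: (np p)].
Qed.

Section Sequencing.
Context (R : realType).
Local Open Scope ring_scope.

(** A halted configuration is a fixed point of [step], so an event that implies halting persists. *)
Lemma steps_mono (Q : config -> Prop) t t' x :
  (forall x, Q x -> code x = [::]) -> (t <= t')%N ->
  pr R (steps t x) Q <= pr R (steps t' x) Q.
Proof.
move=> Qhalt /subnK <-; elim: (t' - t)%N => // k IH; apply: (le_trans IH) => {IH}; rewrite addSn.
elim: (k + t)%N x => [|l IHl] x /=.
  case: asboolP => [Qx|_]; last by rewrite mulr0n pr_ge0.
  by case: x Qx => p s w Qx; move: (Qhalt _ Qx) => /= Ep; rewrite Ep in Qx *; rewrite /= asboolT.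
have := @pr_bind_le R _ _ _ (step x) (steps l) (steps l.+1) Q Q 0.
by rewrite subr0; apply => y; rewrite subr0.
Qed.

(** The code of [p ++ q] evolves as that of [p] with [q] appended, and the work is shifted by [w0].
    The frame condition [agree_from] carries what is stored in arrays from [b] on across the run of
    [p]. *)
Lemma pram_seq (b : nat) (P Q : config -> Prop) (q : program) s0 t t' w0 (d : R) :
  0 <= d -> (forall x, P x -> code x = [::]) -> (forall x, Q x -> code x = [::]) ->
  (forall x, P x -> agree_from b s0 (memory x) ->
     1 - d <= pr R (steps t' (Config q (memory x) (w0 + work x)%N)) Q) ->
  forall p s w, (written_seq p <= b)%N -> agree_from b s0 s ->
  pr R (steps t (Config p s w)) P - d <= pr R (steps (t + t') (Config (p ++ q) s (w0 + w)%N)) Q.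
Proof.
move=> d0 Phalt Qhalt PQ; elim: t => [|t IH] p s w pb ss.
  rewrite [pr R (steps 0 _) _]/=; case: asboolP => [Px|_]; last first.
    by apply: le_trans (pr_ge0 _ _ _); rewrite mulr0n; lra.
  have /= Ep := Phalt _ Px; have := PQ _ Px ss; rewrite Ep /= mulr1n; lra.
(* If [p] halts before its time is up, [q] simply starts earlier and [steps_mono] covers the
   difference. *)
case: p pb => [|c p] pb.
  apply: (le_trans (IH [::] s w pb ss)) => /=.
  by apply: (@steps_mono Q (t + t') (t + t').+1 (Config q s (w0 + w)%N)).
move: pb; rewrite /written_seq /= -/(written_seq p) geq_max => /andP[cb pb].
case: c cb => [k g a i x|k a|e c1 c2|e c1] cb /=.
- rewrite -[(w0 + w + _)%N]addnA -[(w0 + _).+1]addnS; apply: IH => // b' bb'.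
  by rewrite write_par_other ?ss //; apply: contraTneq bb' => ->; rewrite -ltnNge.
- rewrite !bindA; apply: pr_bind_le => l /=.
  rewrite -[(w0 + w + _)%N]addnA -[(w0 + _).+1]addnS; apply: IH => // b' bb'.
  rewrite -ss //; apply: funext => j.
  rewrite /write_bits; have /negbTE -> // : b' != a.
  by apply: contraTneq bb' => ->; rewrite -ltnNge.
- rewrite -[(w0 + w).+1]addnS catA; apply: IH => //; rewrite written_cat geq_max pb andbT.
  move: cb; rewrite geq_max -!/(written_seq _) => /andP[c1b c2b].
  by case: ifP.
- rewrite -[(w0 + w).+1]addnS; case: ifP => _; last exact: IH.
  rewrite -cat_cons catA; apply: IH => //.
  by rewrite written_cat geq_max [written_seq _]/= [written_seq (_ :: _)]/= geq_max pb !andbT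
     -/(written_seq c1) cb.
Qed.

End Sequencing.

(** * The spanner program *)

Section SpannerProgram.
Context (A : program) (b : nat).
Hypothesis b8 : 8 <= b.

(* Arrays of the spanner program, out of reach of [A]: copy of the sizes, flags
   of the remaining vertices, copies of the slot endpoints, flags of the slots
   of H, for each vertex 0 or 1 plus the slot by which it joins a cluster, and
   in cell 0 whether a vertex remains. *)
Definition aN := b.
Definition aV := b.+1.
Definition aE1 := b.+2.
Definition aE2 := b.+3.
Definition aH := b.+4.
Definition aJ := b.+4.+1.
Definition aF := b.+4.+2.

Definition eN := Read aN (Const 0).
Definition eM := Read aN (Const 1).
Definition eNot e := Defs.Sub (Const 1) e.
Definition eAnd e f := eNot (Add (eNot e) (eNot f)).

Lemma eNotE s p e : (eval s p (eNot e) != 0) = (eval s p e == 0).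
Proof. by rewrite /=; case: (eval s p e) => [|[]]. Qed.

Lemma eAndE s p e f :
  (eval s p (eAnd e f) != 0) = (eval s p e != 0) && (eval s p f != 0).
Proof. by rewrite /=; case: (eval s p e) => [|k]; case: (eval s p f) => [|l]. Qed.

(** Both ends are tested in [aV] because array 4 is specified only at remaining vertices; at other
    names [A] may leave any value there. *)
Definition joinable x y :=
  eAnd (eAnd (Read aV (Read x Proc)) (Read aV (Read y Proc)))
       (eAnd (eNot (Read 4 (Read x Proc))) (Read 4 (Read y Proc))).

Lemma joinableE s p x y : (eval s p (joinable x y) != 0) =
  [&& s aV (s x p) != 0, s aV (s y p) != 0, s 4 (s x p) == 0 & s 4 (s y p) != 0].
Proof. by rewrite !eAndE eNotE -andbA. Qed.

(** Loop tests are evaluated by processor 0 alone; concurrent writes of 1 form the disjunction of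
    all vertex flags in constant depth. *)
Definition refresh : program :=
  [:: Par (Const 1) (Const 1) aF Proc (Const 0);
      Par eN (Read aV Proc) aF (Const 0) (Const 1)].

Definition prologue : program :=
  [:: Par (Const 2) (Const 1) aN Proc (Read 0 Proc);
      Par eN (Const 1) aV Proc (Read 1 Proc);
      Par eM (Const 1) aE1 Proc (Read 2 Proc);
      Par eM (Const 1) aE2 Proc (Read 3 Proc);
      Par eM (Const 1) aH Proc (Const 0)] ++ refresh.

(** A deleted vertex loses only its flag, which makes its slots vacant. So [n] and [m] stay those of
    the whole graph and the bounds on [A] apply unchanged in every phase. *)
Definition restore : program :=
  [:: Par (Const 2) (Const 1) 0 Proc (Read aN Proc);
      Par eN (Const 1) 1 Proc (Read aV Proc);
      Par eM (Const 1) 2 Proc (Read aE1 Proc);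
      Par eM (Const 1) 3 Proc (Read aE2 Proc)].

(** A conflict at a cell of [aJ] leaves one slot per vertex, hence at most one joining edge each.
    The two passes treat the two orientations of a slot, the second overriding the first. *)
Definition choose : program :=
  [:: Par (Read 5 (Const 0)) (Const 1) aH (Read 7 Proc) (Const 1);
      Par eN (Const 1) aJ Proc (Const 0);
      Par eM (joinable aE1 aE2) aJ (Read aE1 Proc) (Add Proc (Const 1));
      Par eM (joinable aE2 aE1) aJ (Read aE2 Proc) (Add Proc (Const 1))].

Definition settle : program :=
  [:: Par eN (Read aJ Proc) aH (Defs.Sub (Read aJ Proc) (Const 1)) (Const 1);
      Par eN (Read 4 Proc) aV Proc (Const 0)].

Definition extend : program := choose ++ settle ++ refresh.

Definition loop : instr := While (Read aF (Const 0)) (restore ++ A ++ extend).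

Definition epilogue : program := [:: Par eM (Const 1) 4 Proc (Read aH Proc)].

Definition spanner_program : program := prologue ++ loop :: epilogue.

Lemma spanner_program_det : pram_det A -> pram_det spanner_program.
Proof. by move=> dA; rewrite /pram_det /= !all_cat -/(pram_det A) dA. Qed.

Definition exec1 (c : instr) (s : store) : store :=
  if c is Par k g a i x then write_par s (eval s 0 k) g a i x else s.

Definition cost1 (c : instr) (s : store) : nat :=
  if c is Par k _ _ _ _ then (eval s 0 k).+1 else 0.

Fixpoint exec (p : program) (s : store) : store :=
  if p is c :: q then exec q (exec1 c s) else s.

Fixpoint cost (p : program) (s : store) : nat :=
  if p is c :: q then cost1 c s + cost q (exec1 c s) else 0.

Definition is_par (c : instr) : bool := if c is Par _ _ _ _ _ then true else false.

Lemma steps_exec p q s w t : all is_par p ->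
  steps (size p + t) (Config (p ++ q) s w) = steps t (Config q (exec p s) (w + cost p s)).
Proof.
elim: p s w => [|c p IH] s w /=; first by rewrite addn0.
by case: c => //= k g a i x pp; rewrite IH // addnA addnS.
Qed.

Lemma exec_cat p q s : exec (p ++ q) s = exec q (exec p s).
Proof. by elim: p s => //= c p IH s. Qed.

Lemma cost_cat p q s : cost (p ++ q) s = cost p s + cost q (exec p s).
Proof. by elim: p s => //= c p IH s; rewrite IH addnA. Qed.

Ltac other := repeat match goal with |- context [write_par ?s ?k ?g ?a ?i ?x ?c] =>
  rewrite (@write_par_other s k g a i x c); [| by rewrite /aN /aV /aE1 /aE2 /aH /aJ /aF; lia]
  end.

Lemma refresh_other s a : a != aF -> exec refresh s a = s a.
Proof. by move=> aaF; rewrite /= !write_par_other. Qed.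

Lemma refresh_flag s :
  exec refresh s aF 0 != 0 <-> exists2 i, i < s aN 0 & s aV i != 0.
Proof.
rewrite /exec /refresh [exec1 (Par eN _ _ _ _) _]/= write_par_flag /=.
have E a : a != aF -> write_par s 1 (Const 1) aF Proc (Const 0) a = s a.
  exact: write_par_other.
rewrite write_par_proc /= !E; try by rewrite /aN /aV /aF; lia.
by split=> [[//|[i iN [iV _]]]|[i iN iV]]; [exists i | right; exists i].
Qed.

Lemma refresh_cost s : cost refresh s = 3 + s aN 0.
Proof. by rewrite /=; other; rewrite addn0 addnS. Qed.

Lemma prologueP s (s' := exec prologue s) :
  [/\ s' aN 0 = s 0 0 /\ s' aN 1 = s 0 1,
      forall i, i < s 0 0 -> s' aV i = s 1 i,
      forall e, e < s 0 1 -> [/\ s' aE1 e = s 2 e, s' aE2 e = s 3 e & s' aH e = 0],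
      s' aF 0 != 0 <-> exists2 i, i < s' aN 0 & s' aV i != 0
    & cost prologue s = 10 + 2 * s 0 0 + 3 * s 0 1].
Proof.
rewrite /s' /prologue exec_cat cost_cat refresh_cost.
set s5 := exec _ s.
have N0 : s5 aN 0 = s 0 0 by rewrite /s5 /=; other; rewrite write_par_proc.
have N1 : s5 aN 1 = s 0 1 by rewrite /s5 /=; other; rewrite write_par_proc.
have keep a : a != aF -> exec refresh s5 a = s5 a by apply: refresh_other.
rewrite !(keep aN, keep aV, keep aE1, keep aE2, keep aH);
  try by rewrite /aN /aV /aE1 /aE2 /aH /aF; lia.
split=> //.
- move=> i iN; rewrite /s5 /=; other; rewrite write_par_proc /= write_par_proc /=.
  by rewrite iN /=; other.
- move=> e eM; split.
  + rewrite /s5 /=; other; rewrite write_par_proc /=; other.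
    rewrite write_par_proc /= eM /=; other; by [].
  + rewrite /s5 /=; other; rewrite write_par_proc /=; other.
    rewrite write_par_proc /= eM /=; other; by [].
  + rewrite /s5 /= write_par_proc /=; other.
    by rewrite write_par_proc /= eM.
- exact: refresh_flag.
- rewrite N0 /=; other; rewrite !write_par_proc /=; lia.
Qed.

Lemma restoreP s (s' := exec restore s) :
  [/\ s' 0 0 = s aN 0 /\ s' 0 1 = s aN 1,
      forall i, i < s aN 0 -> s' 1 i = s aV i,
      forall e, e < s aN 1 -> s' 2 e = s aE1 e /\ s' 3 e = s aE2 e,
      agree_from b s s'
    & cost restore s = 6 + s aN 0 + 2 * s aN 1].
Proof.
rewrite /s' /=; split.
- by split; other; rewrite write_par_proc.
- move=> i iN; other; rewrite write_par_proc /=; other; rewrite iN /=.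
  by other.
- move=> e eM; split.
    other; rewrite write_par_proc /=; other; rewrite eM /=; other; by [].
  rewrite write_par_proc /=; other; rewrite eM /=; other; by [].
- by move=> a ba; do 4! (rewrite write_par_other; [|lia]).
- other; lia.
Qed.

Definition chosen (s : store) : nat -> nat := exec choose s aJ.

Definition can_join (s : store) (x y e i : nat) : Prop :=
  [/\ s x e = i, s aV i != 0, s aV (s y e) != 0, s 4 i = 0 & s 4 (s y e) != 0].

Lemma joinableP s p x y i : eval s p (joinable x y) != 0 -> s x p = i -> can_join s x y p i.
Proof. by rewrite joinableE => + <-; case/and4P=> ? ? /eqP. Qed.

Lemma can_join_joinable s e x y i : can_join s x y e i -> eval s e (joinable x y) != 0.
Proof. by rewrite joinableE; case=> <- -> -> -> ->. Qed.

Lemma can_join_ext s s' x y e i :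
  s' x = s x -> s' y = s y -> s' aV = s aV -> s' 4 = s 4 ->
  can_join s' x y e i -> can_join s x y e i.
Proof. by move=> Ex Ey EV E4; rewrite /can_join Ex Ey EV E4. Qed.

(** * Which slot a vertex chooses *)

Section Choice.
Variable s : store.
Let s2 := exec (take 2 choose) s.
Let s3 := exec (take 3 choose) s.

Lemma s2_other a : a != aH -> a != aJ -> s2 a = s a.
Proof. by move=> aH' aJ'; rewrite /s2 /= !write_par_other. Qed.

Lemma s3_other a : a != aH -> a != aJ -> s3 a = s a.
Proof. by move=> aH' aJ'; rewrite /s3 /= !write_par_other. Qed.

Lemma s2J i : i < s aN 0 -> s2 aJ i = 0.
Proof. by move=> iN; rewrite /s2 /= write_par_proc /=; other; rewrite iN. Qed.

Lemma s3E : s3 = write_par s2 (s aN 1) (joinable aE1 aE2) aJ (Read aE1 Proc) (Add Proc (Const 1)).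
Proof. by rewrite /s3 /s2 /=; congr write_par; other. Qed.

Lemma chosenE : chosen s =
  write_par s3 (s aN 1) (joinable aE2 aE1) aJ (Read aE2 Proc) (Add Proc (Const 1)) aJ.
Proof. by rewrite /chosen /s3 /=; congr (write_par _ _ _ _ _ _ _); other. Qed.

Ltac names := by rewrite /aN /aV /aE1 /aE2 /aH /aJ /aF; lia.

Lemma can_join2 x y e i : x != aH -> x != aJ -> y != aH -> y != aJ ->
  can_join s2 x y e i <-> can_join s x y e i.
Proof. by move=> ? ? ? ?; split; apply: can_join_ext; rewrite s2_other //; names. Qed.

Lemma can_join3 x y e i : x != aH -> x != aJ -> y != aH -> y != aJ ->
  can_join s3 x y e i <-> can_join s x y e i.
Proof. by move=> ? ? ? ?; split; apply: can_join_ext; rewrite s3_other //; names. Qed.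

Lemma chosenP i e : i < s aN 0 -> chosen s i = e.+1 ->
  e < s aN 1 /\ (can_join s aE1 aE2 e i \/ can_join s aE2 aE1 e i).
Proof.
move=> iN; rewrite chosenE.
have [[p [pM gp /= ip ->]]|[-> _]] := write_parP s3 (s aN 1) (joinable aE2 aE1) aJ
    (Read aE2 Proc) (Add Proc (Const 1)) i.
  rewrite addn1 => -[<-]; split=> //; right.
  by apply/can_join3; try names; apply: joinableP gp ip.
rewrite s3E; have [[p [pM gp /= ip ->]]|[-> _]] := write_parP s2 (s aN 1)
    (joinable aE1 aE2) aJ (Read aE1 Proc) (Add Proc (Const 1)) i.
  rewrite addn1 => -[<-]; split=> //; left.
  by apply/can_join2; try names; apply: joinableP gp ip.
by rewrite s2J.
Qed.

Lemma chosen_neq0 i e : e < s aN 1 ->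
  can_join s aE1 aE2 e i \/ can_join s aE2 aE1 e i -> chosen s i != 0.
Proof.
move=> eM joinP; rewrite chosenE.
have [[p [_ _ _ ->]]|[-> no3]] := write_parP s3 (s aN 1) (joinable aE2 aE1) aJ
    (Read aE2 Proc) (Add Proc (Const 1)) i; first by rewrite /= addn1.
rewrite s3E; have [[p [_ _ _ ->]]|[-> no2]] := write_parP s2 (s aN 1)
    (joinable aE1 aE2) aJ (Read aE1 Proc) (Add Proc (Const 1)) i; first by rewrite /= addn1.
case: joinP => J.
  have J2 : can_join s2 aE1 aE2 e i by apply/can_join2; try names.
  by case: (no2 e eM (can_join_joinable J2)); case: J2.
have J3 : can_join s3 aE2 aE1 e i by apply/can_join3; try names.
by case: (no3 e eM (can_join_joinable J3)); case: J3.
Qed.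

Lemma extendP (s' := exec extend s) :
  [/\ [/\ s' aN = s aN, s' aE1 = s aE1 & s' aE2 = s aE2],
      forall i, s' aV i = if (i < s aN 0) && (s 4 i != 0) then 0 else s aV i,
      forall e, s' aH e != 0 <-> [\/ s aH e != 0, exists2 j, j < s 5 0 & s 7 j = e |
        exists2 i, i < s aN 0 & chosen s i != 0 /\ (chosen s i).-1 = e],
      s' aF 0 != 0 <-> exists2 i, i < s' aN 0 & s' aV i != 0
    & cost extend s = 9 + s 5 0 + 4 * s aN 0 + 2 * s aN 1].
Proof.
pose s4 := exec choose s; pose s6 := exec settle s4.
have Es' : s' = exec refresh s6 by rewrite /s' /extend !exec_cat.
have keep4 a : a != aH -> a != aJ -> s4 a = s a.
  by move=> aH' aJ'; rewrite /s4 /= !write_par_other.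
have s4N : s4 aN = s aN by apply: keep4; names.
have keep6 a : a != aH -> a != aJ -> a != aV -> s6 a = s a.
  by move=> aH' aJ' aV'; rewrite /s6 /= !write_par_other // keep4.
have s4J : s4 aJ = chosen s by [].
have s6V i : s6 aV i = if (i < s aN 0) && (s 4 i != 0) then 0 else s aV i.
  rewrite /s6 /= write_par_proc /=; other; rewrite s4N.
  by rewrite (keep4 4) ?(keep4 aV) //; names.
have keep a : a != aF -> s' a = s6 a by move=> aF'; rewrite Es' refresh_other.
split.
- by rewrite !keep ?keep6 //; names.
- by move=> i; rewrite keep ?s6V //; names.
- move=> e; rewrite keep; last by names.
  rewrite /s6 /=; other; rewrite write_par_flag /= s4N s4J.
  have -> : s4 aH = write_par s (s 5 0) (Const 1) aH (Read 7 Proc) (Const 1) aH.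
    by rewrite /s4 /=; other.
  rewrite write_par_flag /=; split.
    case=> [[He|[j jK [_ Ej]]]|[i iN [ci Ei]]]; first by constructor 1.
      by constructor 2; exists j.
    by constructor 3; exists i; rewrite // -subn1.
  case=> [He|[j jK Ej]|[i iN [ci Ei]]]; first by left; left.
    by left; right; exists j.
  by right; exists i; rewrite // subn1.
- rewrite (keep aN) ?(keep aV) ?Es'; try names.
  exact: refresh_flag.
- rewrite /extend !cost_cat refresh_cost -/s4 -/s6 keep6; try names.
  rewrite [cost choose s]/= [cost settle s4]/=; other; rewrite s4N; lia.
Qed.

End Choice.

(** * Correctness of the loop *)

Section Correctness.
Context (G : sgraph) (n m : nat) (name : G -> nat) (s0 : store).
Hypothesis inp : pram_input n m name s0.

Definition loop_inv (S : {set G}) (H : {set {set G}}) (s : store) : Prop :=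
  [/\ s aN 0 = n /\ s aN 1 = m,
      forall i, i < n -> s aV i != 0 <-> exists2 v, v \in S & name v = i,
      forall e, e < m -> s aE1 e = s0 2 e /\ s aE2 e = s0 3 e,
      forall e u v, e < m -> slot name s0 e u v -> [set u; v] \in H <-> s aH e != 0
    & s aF 0 != 0 <-> S != set0].

Lemma slot_inj e u v e' u' v' : e < m -> slot name s0 e u v ->
  e' < m -> slot name s0 e' u' v' -> [set u; v] = [set u'; v'] -> e = e'.
Proof.
move=> em se e'm se' E; have uv := pin_adj inp em se.
have [e1 [_ uniq]] := pin_slot inp uv.
have <- : e1 = e by apply: uniq; split=> //; left.
by apply: uniq; split=> //; case/set2_inj: E => -[-> ->]; [left | right].
Qed.

Lemma slot_ends e u v u' v' : slot name s0 e u v -> slot name s0 e u' v' -> u = u' /\ v = v'.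
Proof. by move=> [E2 E3] [E2' E3']; split; apply: (pin_inj inp); congruence. Qed.

Lemma prologue_inv : loop_inv [set: G] set0 (exec prologue s0).
Proof.
have [[N0 N1] PV PE PF _] := prologueP s0.
rewrite (pin_n inp) (pin_m inp) in N0 N1 PV PE.
have usedP i : i < n -> exec prologue s0 aV i != 0 <-> exists2 v, v \in [set: G] & name v = i.
  move=> i_n; rewrite PV //; split=> [/(pin_used inp i_n)[v vi]|[v _ vi]]; first by exists v.
  by apply/(pin_used inp i_n); exists v.
split=> //.
- by move=> e em; have [] := PE e em.
- by move=> e u v em _; have [_ _ ->] := PE e em; rewrite inE.
- rewrite PF N0; split=> [[i i_n /(usedP i i_n)[v _ _]]|/set0Pn[v _]].
    by apply/set0Pn; exists v; rewrite inE.
  by exists (name v); [exact: (pin_name inp) | apply/usedP; [exact: (pin_name inp) | exists v]].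
Qed.

Section Iteration.
Variables (S : {set G}) (H : {set {set G}}) (s : store).
Hypothesis inv : loop_inv S H s.
Let sub_name (v : induced_set S) : nat := name (val v).
Let s1 := exec restore s.

Lemma restore_slot e (u v : induced_set S) : e < m ->
  slot sub_name s1 e u v <-> slot name s0 e (val u) (val v).
Proof.
move=> em; have [[N0 N1] _ IE _ _] := inv; have [_ _ RE _ _] := restoreP s.
rewrite N1 in RE; have [E2 E3] := RE e em; have [I2 I3] := IE e em.
by rewrite /slot /s1 E2 E3 I2 I3.
Qed.

Lemma restore_input : pram_input n m sub_name s1.
Proof.
have [[N0 N1] IV IE _ _] := inv; have [[R0 R1] RV RE _ _] := restoreP s.
rewrite N0 N1 in R0 R1 RV RE.
split=> //.
- by move=> u v /(pin_inj inp)/val_inj.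
- by move=> v; apply: (pin_name inp).
- move=> i i_n; rewrite /s1 RV // IV //; split=> [[v vS vi]|[v vi]].
    by exists (exist _ v vS).
  by exists (val v); first exact: (valP v).
- move=> e em; rewrite /s1; have [-> ->] := RE e em; have [-> ->] := IE e em.
  exact: (pin_ends inp em).
- by move=> e u v em /restore_slot-/(_ em); apply: (pin_adj inp).
- move=> u v uv; have [e [[em se] uniq]] := pin_slot inp uv; exists e; split.
    by split=> //; case: se => se; [left | right]; apply/restore_slot.
  move=> e' [e'm se']; apply: uniq; split=> //.
  by case: se' => /restore_slot-/(_ e'm) se'; [left | right].
Qed.

Variables (X : clustering (induced_set S)) (s2 : store).
Hypothesis agree : agree_from b s1 s2.
Hypothesis enc : pram_encodes_clustering m sub_name s1 s2 X.
Hypothesis trees : {in clusters X, forall C, is_tree (tverts X C) (tedges X C)}.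

Lemma agree_s2 a : b <= a -> s2 a = s a.
Proof. by move=> ba; have [_ _ _ agree1 _] := restoreP s; rewrite agree // /s1 agree1. Qed.

Lemma label_clustered v : v \in S -> (s2 4 (name v) != 0) = (v \in clustered X).
Proof.
move=> vS; have [lab [_ labE _ _ _]] := enc; pose v' : induced_set S := exist _ v vS.
apply/idP/idP.
  case E: (s2 4 (name v)) => [//|l] _; have [C [CX vC _]] := (labE v' l).1 E.
  by apply/imsetP; exists v' => //; apply/bigcupP; exists C.
case/clusteredP=> C [x [CX xC vx]]; have xv : x = v' by apply: val_inj.
by rewrite ((labE v' (lab C)).2 _) //; exists C; rewrite -xv.
Qed.

Lemma joined_slot u e : u \in S -> chosen s2 (name u) = e.+1 -> e < m /\
  exists w, [/\ u \notin clustered X, w \in clustered X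
    & slot name s0 e u w \/ slot name s0 e w u].
Proof.
have [[N0 N1] IV IE _ _] := inv.
move=> uS; have un := pin_name inp u.
case/chosenP; first by rewrite agree_s2 ?N0 // /aN.
rewrite agree_s2 ?N1 /aN // => em joinP; split=> //.
have [E1 E2] := IE e em; have [n2 n3] := pin_ends inp em.
have main x y : s2 x e = name u -> s2 y e < n -> can_join s2 x y e (name u) ->
    exists w, [/\ u \notin clustered X, w \in clustered X & s2 y e = name w].
  move=> Ex yn [_ _ + u0 w0]; rewrite agree_s2 ?/aV ?leqW // => /(IV _ yn)[w wS wy].
  exists w; rewrite -label_clustered // u0 -label_clustered // wy.
  by rewrite w0.
have A1 : s2 aE1 e = s0 2 e by rewrite agree_s2 // /aE1 !leqW.
have A2 : s2 aE2 e = s0 3 e by rewrite agree_s2 // /aE2 !leqW.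
case: joinP => J; have [Ex _ _ _ _] := J.
  have [|w [uX wX Ew]] := main _ _ Ex _ J; first by rewrite A2.
  by exists w; split=> //; left; split; congruence.
have [|w [uX wX Ew]] := main _ _ Ex _ J; first by rewrite A1.
by exists w; split=> //; right; split; congruence.
Qed.

(** Defined from the stored names for every number [e], so that [slot_joins] can be written as an
    image before its slots are known to be valid. *)
Definition slot_set (e : nat) : {set G} := [set x | (name x == s0 2 e) || (name x == s0 3 e)].

Lemma slot_setE e u v : slot name s0 e u v -> slot_set e = [set u; v].
Proof.
move=> [E2 E3]; apply/setP => x; rewrite !inE E2 E3.
by rewrite !(inj_eq (pin_inj inp)).
Qed.

Definition slot_joins : {set {set G}} :=
  [set slot_set (chosen s2 (name u)).-1 | u in [set u in S | chosen s2 (name u) != 0]].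

Lemma slot_joins_joins : joins X slot_joins.
Proof.
have [[N0 N1] IV IE _ _] := inv; split.
- apply/subsetP => _ /imsetP[u + ->]; rewrite inE => /andP[uS].
  case E: chosen => [//|e] _ /=; have [em [w [_ _ sl]]] := joined_slot uS E.
  by case: sl => sl; rewrite (slot_setE sl) mem_edges; apply: (pin_adj inp) em sl.
- apply: leq_trans (leq_imset_card _ _) _; apply: subset_leq_card.
  by apply/subsetP => u; rewrite inE => /andP[].
- move=> u w; rewrite inE => /andP[uX uS] wX uw.
  have wS := subsetP (clustered_sub X) _ wX.
  have [e [[em sl] _]] := pin_slot inp uw.
  have [E1 E2] := IE e em.
  have A1 : s2 aE1 e = s0 2 e by rewrite agree_s2 // /aE1 !leqW.
  have A2 : s2 aE2 e = s0 3 e by rewrite agree_s2 // /aE2 !leqW.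
  have live v : v \in S -> s2 aV (name v) != 0.
    move=> vS; rewrite agree_s2 ?/aV ?leqW //; apply/IV; first exact: (pin_name inp).
    by exists v.
  have u4 : s2 4 (name u) = 0 by apply/eqP/negPn; rewrite label_clustered.
  have w4 : s2 4 (name w) != 0 by rewrite label_clustered.
  have : chosen s2 (name u) != 0.
    apply: (@chosen_neq0 s2 _ e); first by rewrite agree_s2 ?N1 /aN.
    case: sl => -[S2 S3]; [left | right]; split; rewrite ?A1 ?A2 ?S2 ?S3 //; exact: live.
  case E: (chosen s2 (name u)) => [//|e'] _.
  have [e'm [w' [_ w'X sl']]] := joined_slot uS E.
  have E' : slot_set e' = [set u; w'].
    by case: sl' => sl'; rewrite (slot_setE sl') // setUC.
  exists w'; split=> //.
    by rewrite -mem_edges -E'; case: sl' => sl'; rewrite (slot_setE sl') mem_edges;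
      apply: (pin_adj inp) e'm sl'.
  apply/imsetP; exists u; first by rewrite inE uS E.
  by rewrite E.
Qed.

Lemma extend_inv :
  loop_inv (S :\: clustered X) (H :|: forest_edges X :|: slot_joins) (exec extend s2).
Proof.
have [[N0 N1] IV IE IH _] := inv.
have [[XN X1 X2] XV XH XF _] := extendP s2.
have K0 : s2 aN 0 = n by rewrite agree_s2 // /aN.
have liveP i : i < n -> exec extend s2 aV i != 0 <->
    exists2 v, v \in S :\: clustered X & name v = i.
  move=> i_n; rewrite XV K0 i_n /= (agree_s2 (leqW (leqnn b))); split.
    case: ifPn => // i4 /(IV i i_n)[v vS vi]; exists v => //.
    by rewrite inE vS andbT -label_clustered // vi.
  case=> v; rewrite inE => /andP[vX vS] vi.
  by rewrite -vi label_clustered // (negbTE vX) vi; apply/IV => //; exists v.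
split.
- by rewrite XN K0 agree_s2 // /aN.
- exact: liveP.
- by move=> e em; rewrite X1 X2 !agree_s2 ?/aE1 ?/aE2 ?leqW //; apply: IE.
- move=> e u v em sl; rewrite XH !inE.
  have [lab [_ _ treeE _ edgeE]] := enc.
  have -> : s2 aH = s aH by apply: agree_s2; rewrite /aH !leqW.
  split.
    case/orP => [/orP[uvH|/bigcupP[C CX /imsetP[f fC Ef]]]|/imsetP[w + Ew]].
    + by constructor 1; apply/IH; first exact: em; first exact: sl.
    + constructor 2; have [FE _ _ _ _] := trees CX.
      have [c [d [cd Ecd]]] := edgesP (subsetP FE _ fC); rewrite Ecd in fC Ef.
      rewrite lift_set2 in Ef.
      case/set2_inj: Ef => -[Eu Ev]; rewrite Eu Ev in sl.
        have [j jK [_ je]] := edgeE C c d e CX fC em ((restore_slot _ _ em).2 sl).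
        by exists j.
      rewrite setUC in fC.
      have [j jK [_ je]] := edgeE C d c e CX fC em ((restore_slot _ _ em).2 sl).
      by exists j.
    + rewrite inE => /andP[wS cw]; constructor 3.
      exists (name w); first by rewrite K0; apply: (pin_name inp).
      split=> //; move: Ew cw; case E: chosen => [//|e'] /= Ew _.
      have [e'm [w' [_ _ sl']]] := joined_slot wS E.
      case: sl' => sl'; rewrite (slot_setE sl') in Ew;
        by apply: slot_inj e'm sl' em sl (esym Ew).
  case=> [/(IH e u v em sl) -> //|[j jK je]|[i iN [ci ie]]].
  + have [_ [C [u' [v' [CX _ sl' uvC]]]]] := treeE j jK.
    rewrite je in sl'; have [-> ->] := slot_ends sl ((restore_slot _ _ em).1 sl').
    apply/orP; left; apply/orP; right; apply/bigcupP; exists C => //.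
    by rewrite -lift_set2 imset_f.
  + apply/orP; right; apply/imsetP.
    have [e' ce'] : exists e', chosen s2 i = e'.+1 by case: chosen ci => // e'; exists e'.
    have [w wS wi] : exists2 w, w \in S & name w = i.
      have [_ J] := chosenP iN ce'.
      have iV : s aV i != 0.
        by rewrite -(agree_s2 (leqW (leqnn b))); case: J => -[].
      by rewrite K0 in iN; apply/IV.
    exists w; first by rewrite inE wS wi.
    by rewrite wi ie (slot_setE sl).
- rewrite XF XN (agree_s2 (leqnn b)) N0; split=> [[i i_n /(liveP i i_n)[v vS _]]|/set0Pn[v vS]].
    by apply/set0Pn; exists v.
  exists (name v); first exact: (pin_name inp).
  by apply/liveP; [exact: (pin_name inp) | exists v].
Qed.

(** Bounds the processors that mark tree edges. The list has no repetitions and an edge occupies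
    only one slot, so mapping list positions to pairs of a cluster and a tree edge is injective. *)
Lemma tree_count : s2 5 0 <= \sum_(C in clusters X) #|tedges X C|.
Proof.
have [lab [lab_inj _ treeE listE _]] := enc.
pose P (j : 'I_(s2 5 0)) (p : {set induced_set S} * {set induced_set S}) :=
  [/\ p.1 \in clusters X, p.2 \in tedges X p.1, s2 6 j = lab p.1, s2 7 j < m &
   exists u v, p.2 = [set u; v] /\ slot sub_name s1 (s2 7 j) u v].
have [f fP] : {f & forall j, P j (f j)}.
  apply: choice => j; have [jm [C [u [v [CX jC sl uvC]]]]] := treeE j (ltn_ord j).
  by exists (C, [set u; v]); split=> //; exists u, v.
have f_inj : injective f.
  move=> i j fij; apply: val_inj; have [iX _ i6 im [u [v [fi sli]]]] := fP i.
  have [jX _ j6 jm [u' [v' [fj slj]]]] := fP j.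
  apply: (listE i j (ltn_ord i) (ltn_ord j)); first by rewrite i6 j6 fij.
  apply: (slot_inj im ((restore_slot _ _ im).1 sli) jm ((restore_slot _ _ jm).1 slj)).
  by rewrite -!lift_set2 -fi -fj fij.
rewrite -[s2 5 0]card_ord -(card_imset _ f_inj).
rewrite (eq_bigr (fun C => \sum_(g in tedges X C) 1)); last by move=> C _; rewrite sum1_card.
rewrite pair_big_dep sum1dep_card subset_leq_card //.
by apply/subsetP => _ /imsetP[j _ ->]; rewrite inE; have [-> -> _ _ _] := fP j.
Qed.

End Iteration.

Lemma card_named : #|G| <= n.
Proof.
rewrite -[n]card_ord; apply: (@leq_card _ _ (fun v => Ordinal (pin_name inp v))).
by move=> u v [/(pin_inj inp)].
Qed.

Context (R : realType) (T D : nat) (W xi delta : R).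
Hypothesis A_below : written_seq A <= b.
Hypothesis W_ge0 : (0 <= W)%R.
Hypothesis xi_ge0 : (0 <= xi)%R.
Hypothesis delta_ge0 : (0 <= delta)%R.
Hypothesis AP : pram_clusters n m T W D xi delta A.

Definition final (B : R) (x : config) : Prop :=
  [/\ code x = [::], ((work x)%:R <= B)%R
    & exists2 H : {set {set G}}, spanner_inv D xi set0 H &
        pram_encodes_edges m name s0 (memory x) H].

Lemma final_mono B B' x : (B <= B')%R -> final B x -> final B' x.
Proof. by move=> BB' [cx wx Hx]; split=> //; apply: le_trans BB'. Qed.

Lemma final_code B x : final B x -> code x = [::].
Proof. by case. Qed.

Lemma epilogueP H s w : spanner_inv D xi set0 H -> loop_inv set0 H s ->
  exists2 x, steps 2 (Config (loop :: epilogue) s w) = Ret x &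
    final (w%:R + (m + 2)%:R) x.
Proof.
move=> Hinv [[N0 N1] _ _ IH IF].
have F0 : s aF 0 = 0 by apply/eqP/negPn/negP => /IF; rewrite eqxx.
eexists; first by rewrite /= F0 /=.
split=> //=; first by rewrite -natrD ler_nat N1; lia.
exists H => // e u v em sl /=; rewrite write_par_proc /= N1 em /=.
exact: IH em sl.
Qed.

(** The constant part is 1 for the loop test, [6 + n + 2 * m] for [restore] and [9 + 4 * n + 2 * m]
    for [extend]; [n * xi] pays for the list of tree edges. *)
Definition phase_work : R := (W + n%:R * xi + (16 + 5 * n + 4 * m)%:R)%R.

Lemma phase_work_ge0 : (0 <= phase_work)%R.
Proof.
apply: addr_ge0; last exact: ler0n.
by apply: addr_ge0 => //; apply: mulr_ge0.
Qed.

(** An iteration has depth [T + 13]: the loop test, 4 instructions of [restore] and 8 of [extend].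
    The final 2 are the failing test and the epilogue. *)
Lemma loopP k (S : {set G}) H s w : #|S| < 2 ^ k -> spanner_inv D xi S H -> loop_inv S H s ->
  (1 - k%:R * delta <= pr R (steps (k * (T + 13) + 2) (Config (loop :: epilogue) s w))
     (final (w%:R + k%:R * phase_work + (m + 2)%:R)))%R.
Proof.
elim: k S H s w => [|k IH] S H s w Sk Hinv inv; have [S0|S0] := eqVneq S set0.
- rewrite S0 in Hinv inv; have [x Ex fx] := epilogueP w Hinv inv.
  by rewrite mul0n add0n Ex /= !mul0r addr0 subr0 asboolT.
- by move: Sk; rewrite expn0 ltnS leqn0 cards_eq0 (negbTE S0).
- rewrite S0 in Hinv inv; have [x Ex fx] := epilogueP w Hinv inv.
  have fx' : final (w%:R + k.+1%:R * phase_work + (m + 2)%:R) x.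
    apply: final_mono fx; rewrite lerD2r lerDl.
    by apply: mulr_ge0; [exact: ler0n | exact: phase_work_ge0].
  apply: (@le_trans _ _ (pr R (steps 2 (Config (loop :: epilogue) s w))
    (final (w%:R + k.+1%:R * phase_work + (m + 2)%:R)))).
    rewrite Ex /= asboolT // gerBl; apply: mulr_ge0 => //.
  apply: steps_mono; last by rewrite leq_addl.
  exact: final_code.
- have [[N0 N1] _ _ _ IF] := inv; have [_ _ _ _ Rcost] := restoreP s.
  have -> : k.+1 * (T + 13) + 2 = (size restore + (T + (size extend + (k * (T + 13) + 2)))).+1.
    by rewrite /=; lia.
  have F1 : s aF 0 != 0 by apply/IF.
  have -> : steps (size restore + (T + (size extend + (k * (T + 13) + 2)))).+1
      (Config (loop :: epilogue) s w) =
      steps (size restore + (T + (size extend + (k * (T + 13) + 2))))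
      (Config (restore ++ (A ++ (extend ++ loop :: epilogue))) s w.+1).
    by rewrite [LHS]/= F1 -!catA.
  rewrite steps_exec //.
  set s1 := exec restore s; set w1 := w.+1 + cost restore s.
  have := AP (restore_input inv); rewrite -/s1.
  set P := (P in pr R _ P) => AP1.
  (* [A] is specified for runs starting with work 0; the offset [w1] carries the work done
     before. *)
  have := @pram_seq R b P (final (w%:R + k.+1%:R * phase_work + (m + 2)%:R))
    (extend ++ loop :: epilogue) s1 T (size extend + (k * (T + 13) + 2)) w1 (k%:R * delta)%R.
  move=> /(_ _ _ _ _ A s1 0 A_below (fun _ _ => erefl)); rewrite addn0 => seqP.
  suff : (pr R (steps T (Config A s1 0)) P - k%:R * delta <=
     pr R (steps (T + (size extend + (k * (T + 13) + 2)))
       (Config (A ++ extend ++ loop :: epilogue) s1 w1))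
       (final (w%:R + k.+1%:R * phase_work + (m + 2)%:R)))%R.
    apply: le_trans; rewrite -nat1r mulrDl mul1r; move: AP1; lra.
  apply: seqP.
  + by rewrite mulr_ge0.
  + by move=> x [].
  + exact: final_code.
  move=> x [cx wx [X [XP Xenc]]] agree; rewrite steps_exec //.
  have trees : {in clusters X, forall C, is_tree (tverts X C) (tedges X C)}.
    by case: XP => _ tX _ _ _ C /tX[].
  have Sk' : #|S :\: clustered X| < 2 ^ k.
    by apply: card_unclustered Sk; case: XP.
  have joinsX := slot_joins_joins inv agree Xenc.
  have := IH _ _ _ (w1 + work x + cost extend (memory x)) Sk'
    (phase_spanner_inv Hinv XP joinsX) (extend_inv inv agree Xenc trees).
  move/le_trans; apply; apply: pr_mono => y; apply: final_mono.
  rewrite lerD2r -nat1r mulrDl mul1r addrA lerD2r.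
  have [_ _ _ _ ->] := extendP (memory x).
  have treeK := leq_trans (tree_count inv Xenc) (card_tree_edges trees).
  have [_ _ _ _ ov] := XP.
  have E0 : memory x aN = s aN by apply: agree_s2 agree _ _; rewrite /aN.
  rewrite E0 N0 N1 /w1 Rcost N0 N1.
  have SxI : ((memory x 5 0)%:R <= n%:R * xi)%R.
    apply: le_trans (le_trans _ ov) _; first by rewrite ler_nat.
    rewrite card_induced_set ler_wpM2r // ler_nat.
    by apply: leq_trans (max_card _) card_named.
  have Ework : w.+1 + (6 + n + 2 * m) + work x + (9 + memory x 5 0 + 4 * n + 2 * m) =
      w + work x + memory x 5 0 + (16 + 5 * n + 4 * m) by lia.
  rewrite Ework /phase_work !natrD; move: wx SxI; lra.
Qed.

End Correctness.
End SpannerProgram.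

(** Slot [e] joins vertex [e] to [e + 1] modulo 3, while [n] may be any size parameter. *)
Definition K3_store (n : nat) : store := fun a i =>
  match a with
  | 0 => if i is 0 then n else 3
  | 1 => i < 3
  | 2 => i
  | _ => if i is 2 then 0 else i.+1
  end.

Lemma K3_input n : 2 < n -> pram_input n 3 (fun v : K3 => val v) (K3_store n).
Proof.
move=> n2; split=> //.
- exact: val_inj.
- by move=> v; apply: leq_trans (ltn_ord v) n2.
- move=> i _ /=; split=> [|[v <-]]; last by rewrite (ltn_ord v).
  by case: (ltnP i 3) => // i3 _; exists (Ordinal i3).
- by case=> [|[|[|]]] //= _; lia.
- move=> e u v em [/= E2 E3]; apply/negP => /eqP uv; rewrite uv -E3 in E2.
  by case: e em E2 {E3} => [|[|[|]]].
- move=> [[|[|[|u]]] // hu] [[|[|[|v]]] // hv] //= _; rewrite /slot /=.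
  + by exists 0; split; [split; auto | case=> [|[|[|e]]] //= [_ [[]|[]]]].
  + by exists 2; split; [split; auto | case=> [|[|[|e]]] //= [_ [[]|[]]]].
  + by exists 0; split; [split; auto | case=> [|[|[|e]]] //= [_ [[]|[]]]].
  + by exists 1; split; [split; auto | case=> [|[|[|e]]] //= [_ [[]|[]]]].
  + by exists 2; split; [split; auto | case=> [|[|[|e]]] //= [_ [[]|[]]]].
  + by exists 1; split; [split; auto | case=> [|[|[|e]]] //= [_ [[]|[]]]].
Qed.

(** With [Y = n * xi] one has [n <= 2 * Y], hence also [1 <= 2 * Y]. A phase then costs at most
    [W + 43 * Y + 4 * m], and [2 * L] phases give [86 * Y]; prologue and epilogue add [28 * Y]. This
    is the origin of 114. A single factor [L] is consumed, and [L ^ K] dominates it. *)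
Lemma pram_work_bound (R : realType) (K n m L k : nat) (W xi : R) :
  114 <= K -> 0 < n -> 0 < L -> k <= 2 * L -> (0 <= W)%R -> (1 <= 2 * xi)%R ->
  ((10 + 2 * n + 3 * m)%:R + k%:R * phase_work n m W xi + (m + 2)%:R <=
   (K * L ^ K)%:R * (W + m%:R + n%:R * xi))%R.
Proof.
move=> K114 n0 L0 kL W0 xi1.
have m0 : (0 <= m%:R :> R)%R by apply: ler0n.
have n1 : (1 <= n%:R :> R)%R by rewrite ler1n.
have L1 : (1 <= L%:R :> R)%R by rewrite ler1n.
have nxi : (n%:R <= 2 * (n%:R * xi))%R.
  by rewrite mulrCA -[leLHS]mulr1 ler_wpM2l // (le_trans ler01).
have KL : ((114 * L)%:R <= (K * L ^ K)%:R :> R)%R.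
  rewrite ler_nat leq_mul // -{1}(expn1 L) leq_pexp2l //.
  exact: leq_trans K114.
have kR : (k%:R <= 2 * L%:R :> R)%R by rewrite -natrM ler_nat.
have n_ge0 : (0 <= n%:R :> R)%R by apply: ler0n.
rewrite /phase_work.
set Y := (n%:R * xi)%R in nxi *; set Z := (W + Y + _)%R.
have EZ : Z = (W + Y + (16 + 5 * n%:R + 4 * m%:R))%R by rewrite /Z; lra.
have kZ : (k%:R * Z <= L%:R * (2 * W + 86 * Y + 8 * m%:R))%R.
  have Z0 : (0 <= Z)%R by rewrite EZ; lra.
  apply: (le_trans (ler_wpM2r Z0 kR)); rewrite -mulrA mulrCA ler_wpM2l ?ler0n //.
  by rewrite EZ; lra.
have rest : (28 * Y + 4 * m%:R <= L%:R * (28 * Y + 4 * m%:R))%R.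
  by rewrite ler_peMl //; lra.
have sum : (L%:R * (2 * W + 86 * Y + 8 * m%:R) + L%:R * (28 * Y + 4 * m%:R) <=
    L%:R * (114 * (W + m%:R + Y)))%R.
  by rewrite -mulrDr ler_wpM2l ?ler0n //; lra.
have top : (L%:R * (114 * (W + m%:R + Y)) <= (K * L ^ K)%:R * (W + m%:R + Y))%R.
  by rewrite mulrA [(L%:R * _)%R]mulrC -natrM ler_wpM2r //; lra.
by lra.
Qed.

Lemma pram_spanner (R : realType) (K n m T D : nat) (W : nat -> R) (xi delta : R)
    (A : program) (b := maxn 8 (written_seq A)) :
  114 <= K -> 2 < n -> 0 < T ->
  (forall m, pram_clusters n m T (W m) D xi delta A) ->
  pram_spans n m (K * (lg n * T)) ((K * lg n ^ K)%:R * (W m + m%:R + n%:R * xi))%R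
    (K * D) (K%:R * xi)%R ((K * lg n)%:R * delta)%R (spanner_program A b).
Proof.
move=> K114 n2 T0 AP G name s0 inp.
have b8 : 8 <= b by rewrite leq_maxl.
have Ab : written_seq A <= b by rewrite leq_maxr.
have lg0 : 0 < lg n by rewrite trunc_log_gt0 (ltnW n2).
have K6 : 6 <= K by apply: leq_trans K114.
have [d1|d1] := leP 1%R delta.
  by apply: pr_trivial => //; rewrite muln_gt0 lg0 (leq_trans _ K6).
have [_ [_ _ [X [/K3_clustering[D0 xi1] _]]]] := pr_sat (AP 3 _ _ _ (K3_input n2)) d1.
have AG := AP m _ _ _ inp; have d0 := pr_ge_delta AG.
have W0 : (0 <= W m)%R.
  by have [x [_ wx _]] := pr_sat AG d1; apply: le_trans wx; apply: ler0n.
have xi0 : (0 <= xi)%R by move: xi1; lra.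
pose k := (lg n).+1.
have [_ _ _ _ Pcost] := prologueP b8 s0; rewrite (pin_n inp) (pin_m inp) in Pcost.
have Gk : #|[set: G]| < 2 ^ k.
  by rewrite cardsT; apply: card_lg (card_named inp); apply: leq_trans n2.
have loopG := @loopP A b b8 G n m name s0 inp R T D (W m) xi delta Ab W0 xi0 d0 (AP m) k
  setT set0 (exec (prologue b) s0) (0 + cost (prologue b) s0) Gk
  (spanner_inv0 _ _ _) (prologue_inv b8 inp).
rewrite -steps_exec // in loopG.
have kK : k <= K * lg n.
  by apply: leq_trans (lgS_leq (ltnW n2)) _; rewrite leq_mul2r (leq_trans _ K6) ?orbT.
apply: (@le_trans _ _ (pr R (steps (size (prologue b) + (k * (T + 13) + 2))
    (Config (spanner_program A b) s0 0)) (final m name s0 D xi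
      ((0 + cost (prologue b) s0)%:R + k%:R * phase_work n m (W m) xi + (m + 2)%:R)%R))).
  by apply: le_trans loopG; rewrite lerD2l lerN2 ler_wpM2r // ler_nat.
apply: (@le_trans _ _ (pr R (steps (K * (lg n * T)) (Config (spanner_program A b) s0 0))
   (final m name s0 D xi
      ((0 + cost (prologue b) s0)%:R + k%:R * phase_work n m (W m) xi + (m + 2)%:R)%R))).
  apply: steps_mono; first by move=> x [].
  (* [0 < T] gives [T + 13 <= 14 * T]; the 7 steps of the prologue and the 2 last ones raise the
     factor from 28 to 37, well below [K]. *)
  have kT : k * (T + 13) <= 2 * lg n * (14 * T).
    by apply: leq_mul; [exact: lgS_leq (ltnW n2) | lia].
  have LT : 1 <= lg n * T by rewrite muln_gt0 lg0.
  have -> : size (prologue b) = 7 by [].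
  apply: leq_trans (leq_mul K114 (leqnn _)).
  have E : 2 * lg n * (14 * T) = 28 * (lg n * T) by rewrite mulnACA.
  by rewrite E in kT; lia.
apply: pr_mono => x [cx wx [H Hinv Henc]]; split=> //.
  apply: (le_trans wx); rewrite add0n Pcost.
  by apply: pram_work_bound => //; [apply: leq_trans n2 | apply: lgS_leq (ltnW n2)].
by exists H; have [] := spanner_inv_final K6 (or_introl D0) Hinv.
Qed.

Theorem theorem1p7 (R : realType) :
  exists K : nat, forall (D : nat -> nat) (xi delta : nat -> R),
  [/\
    (* no machine model *)
    forall A : nat -> forall G : sgraph, rnd (clustering G),
      (forall n, clusters_with n (D n) (xi n) (delta n) (A n)) ->
      exists A' : nat -> forall G : sgraph, rnd {set {set G}},
        (forall n, 2 < n ->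
           spans_with n (K * D n) (K%:R * xi n)%R
             ((K * lg n)%:R * delta n)%R (A' n)) /\
        ((forall n G, coinless (A n G)) -> forall n G, coinless (A' n G)),
    (* CONGEST *)
    forall (c b : nat) (T : nat -> nat) (A : nat -> protocol input cl_out),
      (forall n, 0 < T n) ->
      (forall n, 1 < n -> bandwidth (A n) (b * lg n)) ->
      (forall n, congest_clusters n c (T n) (D n) (xi n) (delta n) (A n)) ->
      exists (b' : nat) (A' : nat -> protocol input (seq nat)),
        [/\ forall n, 1 < n -> bandwidth (A' n) (b' * lg n),
            forall n, 2 < n ->
              congest_spans n c (K * (lg n * T n)) (K * D n) (K%:R * xi n)%R
                ((K * lg n)%:R * delta n)%R (A' n)
          & (forall n, congest_det (A n)) -> forall n, congest_det (A' n)],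
    (* CONGEST on r-cluster-graphs *)
    forall (c b : nat) (T : nat -> nat -> nat)
        (A : nat -> nat -> protocol cg_input cl_out),
      (forall n r, 0 < T n r) ->
      (forall n r, 1 < n -> bandwidth (A n r) (b * lg n)) ->
      (forall n r,
         cg_congest_clusters n r c (T n r) (D n) (xi n) (delta n) (A n r)) ->
      exists (b' : nat) (A' : nat -> nat -> protocol cg_input (seq nat)),
        [/\ forall n r, 1 < n -> bandwidth (A' n r) (b' * lg n),
            forall n r, 2 < n ->
              cg_congest_spans n r c (K * (lg n * (T n r + r)))
                (K * D n) (K%:R * xi n)%R ((K * lg n)%:R * delta n)%R (A' n r)
          & (forall n r, congest_det (A n r)) ->
            forall n r, congest_det (A' n r)]
  & (* PRAM *)
    forall (T : nat -> nat) (W : nat -> nat -> R) (A : program),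
      (forall n, 0 < T n) ->
      (forall n m,
         pram_clusters n m (T n) (W m n) (D n) (xi n) (delta n) A) ->
      exists A' : program,
        (forall n m, 2 < n ->
           pram_spans n m (K * (lg n * T n))
             ((K * lg n ^ K)%:R * (W m n + m%:R + n%:R * xi n))%R
             (K * D n) (K%:R * xi n)%R ((K * lg n)%:R * delta n)%R A') /\
        (pram_det A -> pram_det A')].
Proof.
(* Only the PRAM work bound asks for 114; for stretch, size and CONGEST rounds 6 is enough. *)
exists 114 => D xi delta; split.
- by move=> A AP; apply: spanner_without_model.
- move=> c b T A T0 bA AP.
  (* The protocol's own messages have one bit, which must fit even if [b = 0]. *)
  exists b.+1, (fun n => plain_spanner_protocol (T n) (A n)); split.
  + move=> n n1; have lg0 : 0 < lg n by rewrite trunc_log_gt0.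
    apply: spanner_protocol_bandwidth; last by rewrite muln_gt0.
    by move=> s u; apply: leq_trans (bA n n1 s u) _; rewrite leq_mul2r leqnSn orbT.
  + by move=> n n2; apply: congest_spanner => //; apply: AP.
  + by move=> dA n; apply: spanner_protocol_det; apply: dA.
- move=> c b T A T0 bA AP.
  exists b.+1, (fun n r => spanner_protocol (T n r) r (A n r)); split.
  + move=> n r n1; have lg0 : 0 < lg n by rewrite trunc_log_gt0.
    apply: spanner_protocol_bandwidth; last by rewrite muln_gt0.
    by move=> s u; apply: leq_trans (bA n r n1 s u) _; rewrite leq_mul2r leqnSn orbT.
  + by move=> n r n2; apply: cg_congest_spanner => //; apply: AP.
  + by move=> dA n r; apply: spanner_protocol_det; apply: dA.
- move=> T W A T0 AP; exists (spanner_program A (maxn 8 (written_seq A))); split.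
    by move=> n m n2; apply: (@pram_spanner R 114 n m (T n) (D n) (fun m => W m n)) => // m';
      apply: AP.
  exact: spanner_program_det.
Qed.
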